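(* Let $A$ be a graded commutative unitary algebra, $k$ an odd integer, $t$ a central variable of degree $1-k$, and let $\Delta\in\operatorname{End}^0_{u,\mathbb{K}[[t]]}(A[[t]])$, i.e. $\Delta$ is a degree zero $\mathbb{K}[[t]]$-linear endomorphism of $A[[t]]$ with $\Delta(\mathbf{1}_A)=0$. Then \[ \kappa(\exp(s\Delta))_n(a_1,\ldots,a_n)\equiv0\pmod{t^{n-1}}\quad\text{for all } n\ge2 \text{ and } a_1,\ldots,a_n\in A \] if and only if \[ \mathcal{K}(\Delta)_n(a_1,\ldots,a_n)\equiv0\pmod{t^{n-1}}\quad\text{for all } n\ge2 \text{ and } a_1,\ldots,a_n\in A, \] that is, if and only if $\Delta\in\mathcal{BV}_{[k]}(A)^0$.
   Context: $\mathbb{K}$ is a field of characteristic zero; spaces are $\mathbb{Z}$-graded. Here $s$ is a central variable of degree $0$ and the formal flow $\exp(s\Delta)=\sum_{n\ge0}\frac{s^n}{n!}\Delta^n$ is regarded as a degree zero unit-preserving $\mathbb{K}[[s,t]]$-linear endomorphism of the algebra of formal power series $A[[s,t]]$. Koszul brackets: for an endomorphism $\Delta$ with $\Delta(\mathbf{1})=0$, $\mathcal{K}(\Delta)_n(a_1,\ldots,a_n)=\sum_{i=1}^n\sum_{\sigma\in S(i,n-i)}\pm_K(-1)^{n-i}\Delta(a_{\sigma(1)}\cdots a_{\sigma(i)})a_{\sigma(i+1)}\cdots a_{\sigma(n)}$, where $S(i,n-i)$ is the set of $(i,n-i)$-unshuffles and $\pm_K$ is the Koszul sign. Cumulants: for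 a degree zero linear map $f$ of graded commutative unitary algebras with $f(\mathbf{1})=\mathbf{1}$, $\kappa(f)_n(a_1,\ldots,a_n)=\sum_{k=1}^n\sum_{I_1\sqcup\cdots\sqcup I_k=\{1,\ldots,n\}}(-1)^{k-1}(k-1)!\pm_K\prod_{j=1}^kf(\prod_{i\in I_j}a_i)$, summed over unordered partitions into nonempty subsets. $\operatorname{Diff}_{u,\le m}(A)=\{\Delta\in\operatorname{End}(A):\Delta(\mathbf{1}_A)=0,\ \mathcal{K}(\Delta)_{m+1}=0\}$. $\mathcal{BV}_{[k]}(A)$ is the graded subspace of the $\mathbb{K}[[t]]$-linear endomorphisms of $A[[t]]$ annihilating $\mathbf{1}_A$ spanned by those $\Delta=\sum_{n\ge0}t^n\Delta_n$ such that $\Delta_n\in\operatorname{Diff}_{u,\le n+1}(A)$ for all $n\ge0$; $\mathcal{BV}_{[k]}(A)^0$ is its degree zero part. *)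

(* Defs.v *)
From HB Require Import structures.
From mathcomp Require Import all_boot all_order all_fingroup all_algebra.
From mathcomp Require Import boolp.

Set Implicit Arguments.
Unset Strict Implicit.
Unset Printing Implicit Defensive.

Import GRing.Theory.
Local Open Scope ring_scope.

(* Formal power series in one central variable. A[[t]] is {fps A}, and
   A[[s,t]] is {fps {fps A}} = A[[t]][[s]]. *)
Record fps (V : Type) : Type := FPS { coefs :> nat -> V }.

Notation "{ 'fps' V }" := (fps V) (format "{ 'fps'  V }") : type_scope.

Lemma fpsP (V : Type) (f g : {fps V}) : (forall n, f n = g n) -> f = g.
Proof.
by case: f g => [f] [g] /= fg; congr FPS; apply: functional_extensionality_dep.
Qed.

HB.instance Definition _ (V : Type) := gen_eqMixin {fps V}.
HB.instance Definition _ (V : Type) := gen_choiceMixin {fps V}.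

Section FpsZmodule.
Variable V : zmodType.
Implicit Types f g h : {fps V}.

Definition fps_zero : {fps V} := FPS (fun=> 0).
Definition fps_opp f : {fps V} := FPS (fun n => - f n).
Definition fps_add f g : {fps V} := FPS (fun n => f n + g n).

Fact fps_addA : associative fps_add.
Proof. by move=> f g h; apply: fpsP => n /=; rewrite addrA. Qed.
Fact fps_addC : commutative fps_add.
Proof. by move=> f g; apply: fpsP => n /=; rewrite addrC. Qed.
Fact fps_add0 : left_id fps_zero fps_add.
Proof. by move=> f; apply: fpsP => n /=; rewrite add0r. Qed.
Fact fps_addN : left_inverse fps_zero fps_opp fps_add.
Proof. by move=> f; apply: fpsP => n /=; rewrite addNr. Qed.

HB.instance Definition _ :=
  GRing.isZmodule.Build {fps V} fps_addA fps_addC fps_add0 fps_addN.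

Lemma fps_coef0 n : (0 : {fps V}) n = 0. Proof. by []. Qed.
Lemma fps_coefN f n : (- f) n = - f n. Proof. by []. Qed.
Lemma fps_coefD f g n : (f + g) n = f n + g n. Proof. by []. Qed.

Lemma fps_coef_sum (I : Type) (r : seq I) (P : pred I) (F : I -> {fps V}) n :
  (\sum_(i <- r | P i) F i) n = \sum_(i <- r | P i) F i n.
Proof. by elim/big_rec2: _ => // i x y _ <-. Qed.

Definition fpsC (c : V) : {fps V} := FPS (fun n => if n == 0 then c else 0).

Lemma sum_triangle (F : nat -> nat -> V) n :
  \sum_(i < n.+1) \sum_(j < (n - i).+1) F i j =
  \sum_(l < n.+1) \sum_(i < l.+1) F i (l - i)%N.
Proof.
elim: n => [|n IHn]; first by rewrite !big_ord1.
rewrite [RHS]big_ord_recr -IHn [LHS]big_ord_recr /= subnn big_ord1.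
have step (i : 'I_n.+1) : \sum_(j < (n.+1 - i).+1) F i j =
    \sum_(j < (n - i).+1) F i j + F i (n.+1 - i)%N.
  by rewrite big_ord_recr /= subSn ?leq_ord.
rewrite (eq_bigr _ (fun i _ => step i)) big_split /= -addrA; congr (_ + _).
by rewrite [RHS]big_ord_recr /= subnn.
Qed.

End FpsZmodule.

Notation "c %:S" := (fpsC c) (at level 2, left associativity, format "c %:S")
  : ring_scope.

Section FpsRing.
Variable R : pzRingType.
Implicit Types f g h : {fps R}.

Definition fps_mul f g : {fps R} :=
  FPS (fun n => \sum_(i < n.+1) f i * g (n - i)%N).

Fact fps_mulA : associative fps_mul.
Proof.
move=> f g h; apply: fpsP => n /=.
under eq_bigr do rewrite mulr_sumr.
rewrite (sum_triangle (fun i j => f i * (g j * h (n - i - j)%N))).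
apply: eq_bigr => l _; rewrite mulr_suml; apply: eq_bigr => i _.
by rewrite mulrA -subnDA subnKC // -ltnS.
Qed.
Fact fps_mul1 : left_id (1%:S) fps_mul.
Proof.
move=> f; apply: fpsP => n /=.
rewrite big_ord_recl /= subn0 mul1r big1 ?addr0 // => i _.
by rewrite mul0r.
Qed.
Fact fps_mulr1 : right_id (1%:S) fps_mul.
Proof.
move=> f; apply: fpsP => n /=.
rewrite big_ord_recr /= subnn mulr1 big1 ?add0r // => i _.
by rewrite subn_eq0 leqNgt ltn_ord mulr0.
Qed.
Fact fps_mulDl : left_distributive fps_mul +%R.
Proof.
move=> f g h; apply: fpsP => n; rewrite fps_coefD /= -big_split /=.
by apply: eq_bigr => i _; rewrite mulrDl.
Qed.
Fact fps_mulDr : right_distributive fps_mul +%R.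
Proof.
move=> f g h; apply: fpsP => n; rewrite fps_coefD /= -big_split /=.
by apply: eq_bigr => i _; rewrite mulrDr.
Qed.

HB.instance Definition _ := GRing.Zmodule_isPzRing.Build {fps R}
  fps_mulA fps_mul1 fps_mulr1 fps_mulDl fps_mulDr.

Lemma fps_coefM f g n : (f * g) n = \sum_(i < n.+1) f i * g (n - i)%N.
Proof. by []. Qed.

Lemma fps_coef1 n : (1 : {fps R}) n = (n == 0)%:R.
Proof. by case: n. Qed.

Definition fpsX : {fps R} := FPS (fun n => (n == 1)%:R).

End FpsRing.

Arguments fpsX {R}.

(* The K[[t]]-module structure of V[[t]]. *)
Section FpsLmodule.
Variables (R : pzRingType) (V : lmodType R).
Implicit Types (c : {fps R}) (f g : {fps V}).

Definition fps_scale c f : {fps V} :=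
  FPS (fun n => \sum_(i < n.+1) c i *: f (n - i)%N).

Fact fps_scaleA c c' f : fps_scale c (fps_scale c' f) = fps_scale (c * c') f.
Proof.
apply: fpsP => n /=.
under eq_bigr do rewrite scaler_sumr.
rewrite (sum_triangle (fun i j => c i *: (c' j *: f (n - i - j)%N))).
apply: eq_bigr => l _; rewrite scaler_suml; apply: eq_bigr => i _.
by rewrite scalerA -subnDA subnKC // -ltnS.
Qed.
Fact fps_scale1 : left_id 1 fps_scale.
Proof.
move=> f; apply: fpsP => n /=.
rewrite big_ord_recl /= subn0 scale1r big1 ?addr0 // => i _.
by rewrite scale0r.
Qed.
Fact fps_scaleDr : right_distributive fps_scale +%R.
Proof.
move=> c f g; apply: fpsP => n; rewrite fps_coefD /= -big_split /=.
by apply: eq_bigr => i _; rewrite scalerDr.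
Qed.
Fact fps_scaleDl f : {morph fps_scale^~ f : c c' / c + c'}.
Proof.
move=> c c'; apply: fpsP => n; rewrite fps_coefD /= -big_split /=.
by apply: eq_bigr => i _; rewrite scalerDl.
Qed.

HB.instance Definition _ := GRing.Zmodule_isLmodule.Build {fps R} {fps V}
  fps_scaleA fps_scale1 fps_scaleDr fps_scaleDl.

Lemma fps_coefZ c f n : (c *: f) n = \sum_(i < n.+1) c i *: f (n - i)%N.
Proof. by []. Qed.

End FpsLmodule.

(* A graded commutative algebra is presented by its total space A together with
   the subspaces of homogeneous elements: [G i a] says that a has degree i. *)
Record gradedCom (K : fieldType) (A : algType K) := GradedCom {
  hom :> int -> A -> Prop;
  hom0 : forall i, hom i 0;
  homD : forall i a b, hom i a -> hom i b -> hom i (a + b);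
  homZ : forall i (c : K) a, hom i a -> hom i (c *: a);
  hom_decomp : forall a, exists (s : seq int) (f : int -> A),
    (forall i, hom i (f i)) /\ a = \sum_(i <- s) f i;
  hom_indep : forall (s : seq int) (f : int -> A), uniq s ->
    (forall i, hom i (f i)) -> \sum_(i <- s) f i = 0 ->
    forall i, i \in s -> f i = 0;
  hom1 : hom 0 1;
  homM : forall i j a b, hom i a -> hom j b -> hom (i + j) (a * b);
  homC : forall i j a b, hom i a -> hom j b ->
    a * b = (-1) ^+ absz (i * j) * (b * a)
}.

(* Homogeneous series of degree i in A[[t]], where t has degree 1 - k. *)
Definition fps_hom (K : fieldType) (A : algType K) (k : int) (G : gradedCom A)
    (i : int) (f : {fps A}) : Prop :=
  forall n : nat, G (i - n%:Z * (1 - k)) (f n).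

Definition has_degree (V : Type) (H : int -> V -> Prop) (p : int)
    (D : V -> V) : Prop :=
  forall i x, H i x -> H (i + p) (D x).

(* The graded space of linear endomorphisms is the direct sum of its homogeneous
   components, hence the finite sums. *)
Definition graded_End (R : pzRingType) (V : lmodType R) (H : int -> V -> Prop)
    (D : V -> V) : Prop :=
  exists (m : nat) (p : 'I_m -> int) (E : 'I_m -> {linear V -> V}),
    (forall i, has_degree H (p i) (E i)) /\
    (forall x, D x = \sum_(i < m) E i x).

(* The Koszul sign of x_1, ..., x_n |-> x_(w 0), x_(w 1), ... is
   (-1) ^+ koszul_exp d w, where d gives the degrees: each inversion
   contributes the product of the two degrees. *)
Fixpoint koszul_exp (n : nat) (d : 'I_n -> int) (w : seq 'I_n) : nat :=
  if w is x :: w' then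
    (\sum_(y <- w' | (y < x)%N) absz (d x * d y)%R + koszul_exp d w')%N
  else 0%N.

Definition unshuffle (n i : nat) (s : 'S_n) : bool :=
  [forall p : 'I_n, forall q : 'I_n,
     (p < q)%N && ((q < i) || (i <= p))%N ==> (s p < s q)%N].

(* K(D)_n (a_1, ..., a_n) for homogeneous a_i of degree d_i. *)
Definition koszul_bracket (B : pzRingType) (D : B -> B) (n : nat)
    (d : 'I_n -> int) (a : 'I_n -> B) : B :=
  \sum_(1 <= i < n.+1) \sum_(s : 'S_n | unshuffle i s)
    (-1) ^+ koszul_exp d [seq s p | p <- enum 'I_n] * (-1) ^+ (n - i) *
    D (\prod_(p < n | (p < i)%N) a (s p)) * \prod_(p < n | (i <= p)%N) a (s p).

(* kappa(f)_n (a_1, ..., a_n) for homogeneous a_i of degree d_i. The blocks of a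
   partition are multiplied in the order of [enum P], and the Koszul sign is
   taken for that order. *)
Definition cumulant (B C : pzRingType) (f : B -> C) (n : nat)
    (d : 'I_n -> int) (a : 'I_n -> B) : C :=
  \sum_(1 <= k < n.+1)
  \sum_(P : {set {set 'I_n}} | partition P [set: 'I_n] && (#|P| == k))
    (-1) ^+ k.-1 * (k.-1)`!%:R *
    (-1) ^+ koszul_exp d (flatten [seq enum J | J : {set 'I_n} <- enum P]) *
    \prod_(J <- enum P) f (\prod_(i <- enum J) a i).

(* exp(s D) on A[[s,t]] = A[[t]][[s]], as the s-linear extension of
   sum_n s^n / n! D^n. *)
Definition exp_flow (K : fieldType) (A : algType K) (D : {fps A} -> {fps A})
    (F : {fps {fps A}}) : {fps {fps A}} :=
  FPS (fun m => \sum_(i < m.+1) ((i`!)%:R^-1 : K)%:S *: iter i D (F (m - i)%N)).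

(* y = 0 modulo the ideal generated by a central element x. *)
Definition eq0_mod (B : pzRingType) (x y : B) : Prop := exists z, y = x * z.

(* Diff_{u, <= m}(A) *)
Definition Diff_u (K : fieldType) (A : algType K) (G : gradedCom A) (m : nat)
    (D : A -> A) : Prop :=
  [/\ graded_End (V := A) G D, D 1 = 0 &
      forall (d : 'I_m.+1 -> int) (a : 'I_m.+1 -> A),
        (forall i, G (d i) (a i)) -> koszul_bracket D d a = 0].

(* Delta_n, for Delta = sum_n t^n Delta_n. *)
Definition coef_endo (V : zmodType) (D : {fps V} -> {fps V}) (n : nat) (a : V) : V :=
  D a%:S n.

Definition BV_gen (K : fieldType) (A : algType K) (k : int) (G : gradedCom A)
    (D : {fps A} -> {fps A}) : Prop :=
  [/\ exists p, has_degree (fps_hom k G) p D, D 1 = 0 &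
      forall n, Diff_u G n.+1 (coef_endo D n)].

Definition BV (K : fieldType) (A : algType K) (k : int) (G : gradedCom A)
    (D : {fps A} -> {fps A}) : Prop :=
  exists (m : nat) (c : 'I_m -> K) (E : 'I_m -> {linear {fps A} -> {fps A}}),
    (forall i, BV_gen k G (E i)) /\
    (forall x, D x = \sum_(i < m) (c i)%:S *: E i x).

Definition BV0 (K : fieldType) (A : algType K) (k : int) (G : gradedCom A)
    (D : {fps A} -> {fps A}) : Prop :=
  BV k G D /\ has_degree (fps_hom k G) 0 D.

(* Main.v *)
Require Import Defs.
From HB Require Import structures.
From mathcomp Require Import all_boot all_order all_fingroup all_algebra.
From mathcomp Require Import boolp ring zify.

Set Implicit Arguments.
Unset Strict Implicit.
Unset Printing Implicit Defensive.

Import GRing.Theory.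
Local Open Scope ring_scope.

(** Both the cumulants and the Koszul brackets are top coefficients of
    logarithmic derivatives in one commutative ring. Attach to the arguments
    [a_1, ..., a_n] formal variables [x_1, ..., x_n] with [x_i ^ 2 = 0], where
    [x_i] has the degree of [a_i]; the [x_i] obey the sign rule among themselves
    and commute with the coefficients. The sums of [b_I x_I], with [b_I] in
    [A[[t]]] homogeneous of the degree of [a_I], form a commutative ring, the
    envelope [env]. Put [u_i = a_i x_i],
    [E = prod_i (1 + u_i) = sum_I a_I x_I] and [F = exp (s Delta) E]. Then
    - the coefficient of [x_1 ... x_n] in [log F] is the cumulant of
      [exp (s Delta)], because the blocks of a partition give a family of
      elements of square zero, for which the power series of [log] becomes the
      sum over partitions ([sum_exp_elsym], [deriv_sqz_log], [cumulantE]);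
    - [d/ds log F = F^-1 Delta F], and at [s = 0] its coefficient of
      [x_1 ... x_n] is the Koszul bracket ([log_gen_flow1]).
    So the bracket is the coefficient of [s] in the cumulant, and divisibility
    of the cumulants implies that of the brackets.

    For the converse, let [Q_s] be the operator [y |-> F^-1 Delta (F y)]. Since
    [dF/ds = Delta F], it satisfies [dQ/ds = [Q, Q 1]], an equation that refers
    to [F] no more. Call an element admissible if its coefficient at [x_I] is
    divisible by [t ^ (#|I| - 1)], and an operator stable if all its iterated
    commutators with admissible elements take [1] to admissible elements.
    Evaluated on monomials [t ^ m c x_J], iterated commutators of [Delta] are
    Koszul brackets up to sign ([expand_mono]), so the divisibility of the
    brackets says that [Delta] is stable ([stable_env_Delta]). Conjugation by
    [1 + u_i] preserves stability, hence [Q_0 = E^-1 Delta E] is stable, and the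
    differential equation propagates stability to every coefficient of [Q_s]
    ([stable_conj_coef]). As [d/ds log F = Q_s 1], and as [log E = sum_i u_i]
    does not contribute for [n >= 2], the coefficient of [x_1 ... x_n] in
    [log F] is divisible by [t ^ (n - 1)].

    The bracket condition for [Delta = sum_j t ^ j Delta_j] says that the
    brackets of [Delta_j] vanish in all arities at least [j + 2]. Membership in
    the filtration only gives arity [j + 2], and the higher arities follow from
    [K(a, b, l) = K(a b, l) - K(a, l) b - K(b, l) a], up to signs
    ([list_bracket_cons2]). *)

(** * Power series *)

Fact fps_mulC (C : comPzRingType) : commutative (@fps_mul C).
Proof.
move=> f g; apply: fpsP => n /=; rewrite (reindex_inj rev_ord_inj) /=.
by apply: eq_bigr => i _; rewrite subSS subKn ?leq_ord // mulrC.
Qed.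

HB.instance Definition _ (C : comPzRingType) :=
  GRing.PzRing_hasCommutativeMul.Build {fps C} (@fps_mulC C).

Definition torsion_free (V : zmodType) :=
  forall n (x : V), x *+ n.+1 = 0 -> x = 0.

Lemma fps_coefMn (V : zmodType) (f : {fps V}) k n : (f *+ k) n = f n *+ k.
Proof. by elim: k => // k IHk; rewrite !mulrS fps_coefD IHk. Qed.

Lemma torsion_free_fps (V : zmodType) :
  torsion_free V -> torsion_free {fps V}.
Proof.
move=> tf n f fn0; apply: fpsP => m; apply: (tf n).
by rewrite -fps_coefMn fn0.
Qed.

Lemma torsion_free_inj (V : zmodType) n (x y : V) :
  torsion_free V -> x *+ n.+1 = y *+ n.+1 -> x = y.
Proof.
move=> tf exy; apply/eqP; rewrite -subr_eq0; apply/eqP/(tf n).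
by rewrite mulrnBl exy subrr.
Qed.

Lemma fps_coefCM (B : pzRingType) (c : B) (f : {fps B}) n :
  (c%:S * f) n = c * f n.
Proof.
rewrite fps_coefM big_ord_recl /= subn0 big1 ?addr0 // => i _.
by rewrite mul0r.
Qed.

Lemma fps_coefMC (B : pzRingType) (c : B) (f : {fps B}) n :
  (f * c%:S) n = f n * c.
Proof.
rewrite fps_coefM big_ord_recr /= subnn big1 ?add0r // => i _.
by rewrite subn_eq0 leqNgt ltn_ord mulr0.
Qed.

Lemma fpsCM (B : pzRingType) (c c' : B) : (c * c')%:S = c%:S * c'%:S.
Proof. by apply: fpsP => n; rewrite fps_coefCM /=; case: eqP; rewrite ?mulr0. Qed.

Definition fps_map (V W : Type) (P : V -> W) (f : {fps V}) : {fps W} :=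
  FPS (fun n => P (f n)).

Definition fps_deriv (V : zmodType) (f : {fps V}) : {fps V} :=
  FPS (fun n => f n.+1 *+ n.+1).

Lemma fps_derivD (V : zmodType) : {morph @fps_deriv V : f g / f + g}.
Proof. by move=> f g; apply: fpsP => n; rewrite /= mulrnDl. Qed.

Lemma fps_deriv_leibniz (B : pzRingType) (f g : {fps B}) :
  fps_deriv (f * g) = fps_deriv f * g + f * fps_deriv g.
Proof.
apply: fpsP => n; rewrite /= -sumrMnl.
have split_deg (i : 'I_n.+2) : f i * g (n.+1 - i)%N *+ n.+1 =
    f i * g (n.+1 - i)%N *+ i + f i * g (n.+1 - i)%N *+ (n.+1 - i).
  by rewrite -mulrnDr subnKC // -ltnS.
rewrite (eq_bigr _ (fun i _ => split_deg i)).
rewrite big_split /=; congr (_ + _).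
  rewrite big_ord_recl mulr0n add0r; apply: eq_bigr => i _.
  by rewrite lift0 subSS mulrnAl.
rewrite big_ord_recr /= subnn mulr0n addr0; apply: eq_bigr => i _.
by rewrite subSn ?leq_ord // mulrnAr.
Qed.

(** * Flows in a commutative ring *)

Section Flow.
Variable C : comPzRingType.
Implicit Types (P Q : C -> C) (u x y : C) (us : seq C).

Definition comm P u : C -> C := fun x => P (u * x) - u * P x.

(** [[...[P, u_1], ..., u_n] 1]: on a commutative ring these are the Koszul
    brackets of [P]. *)
Fixpoint brackets P us : C :=
  if us is u :: us' then brackets (comm P u) us' else P 1.

Definition add_op P := forall x y, P (x + y) = P x + P y.

Lemma add_op0 P : add_op P -> P 0 = 0.
Proof. by move=> addP; apply: (addrI (P 0)); rewrite -addP !addr0. Qed.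

Lemma add_opB P : add_op P -> forall x y, P (x - y) = P x - P y.
Proof.
by move=> addP x y; apply: (addIr (P y)); rewrite -addP !subrK.
Qed.

Lemma add_opMn P n x : add_op P -> P (x *+ n) = P x *+ n.
Proof.
move=> addP; elim: n => [|n IHn]; first by rewrite !mulr0n add_op0.
by rewrite !mulrS addP IHn.
Qed.

Lemma add_op_sum P (I : Type) (r : seq I) (p : pred I) (F : I -> C) :
  add_op P -> P (\sum_(i <- r | p i) F i) = \sum_(i <- r | p i) P (F i).
Proof. by move=> addP; apply: (big_morph P addP); apply: add_op0. Qed.

Lemma add_op_comm P u : add_op P -> add_op (comm P u).
Proof. by move=> addP x y; rewrite /comm mulrDr !addP mulrDr; ring. Qed.

Lemma brackets_eq P Q us : P =1 Q -> brackets P us = brackets Q us.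
Proof. by move=> /funext ->. Qed.

Lemma bracketsD P Q us :
  brackets (fun x => P x + Q x) us = brackets P us + brackets Q us.
Proof.
elim: us P Q => //= u us IHus P Q; rewrite -IHus; apply: brackets_eq => x.
by rewrite /comm; ring.
Qed.

Lemma brackets0 us : brackets (fun=> 0) us = 0.
Proof.
elim: us => //= u us IHus; rewrite -[RHS]IHus; apply: brackets_eq => x.
by rewrite /comm mulr0 subr0.
Qed.

Lemma bracketsMn P n us : brackets (fun x => P x *+ n) us = brackets P us *+ n.
Proof.
elim: n => [|n IHn]; first by rewrite mulr0n -[RHS](brackets0 us).
rewrite mulrS -IHn -bracketsD; apply: brackets_eq => x.
by rewrite mulrS.
Qed.

Lemma brackets_sum (I : finType) (p : pred I) (F : I -> C -> C) us :
  brackets (fun x => \sum_(i | p i) F i x) us =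
  \sum_(i | p i) brackets (F i) us.
Proof.
elim: (index_enum I) => [|i r IHr].
  by rewrite big_nil -[RHS](brackets0 us); apply: brackets_eq => x; rewrite big_nil.
rewrite big_cons -IHr; case: ifP => pi.
  by rewrite -bracketsD; apply: brackets_eq => x; rewrite big_cons pi.
by apply: brackets_eq => x; rewrite big_cons pi.
Qed.

Variable M : C -> Prop.
Hypothesis M0 : M 0.
Hypothesis MD : forall x y, M x -> M y -> M (x + y).
Hypothesis Mdiv : forall n x, M (x *+ n.+1) -> M x.

Definition stable P :=
  forall us, (forall u, u \in us -> M u) -> M (brackets P us).

Lemma stable1 P : stable P -> M (P 1).
Proof. by move=> /(_ [::]); apply. Qed.

Lemma stable_comm P u : stable P -> M u -> stable (comm P u).
Proof.
move=> stP Mu us Mus; apply: (stP (u :: us)) => v; rewrite inE.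
by case/orP => [/eqP-> // | /Mus].
Qed.

Lemma stableD P Q : stable P -> stable Q -> stable (fun x => P x + Q x).
Proof.
by move=> stP stQ us Mus; rewrite bracketsD; apply: MD; [apply: stP | apply: stQ].
Qed.

Lemma stable_sum (I : finType) (F : I -> C -> C) :
  (forall i, stable (F i)) -> stable (fun x => \sum_i F i x).
Proof.
move=> stF us Mus; rewrite brackets_sum; elim/big_ind: _ => //.
by move=> i _; apply: stF.
Qed.

Lemma stable_div P n : stable (fun x => P x *+ n.+1) -> stable P.
Proof.
by move=> stP us Mus; apply: (Mdiv (n := n)); rewrite -bracketsMn; apply: stP.
Qed.

Lemma stable_eq P Q : P =1 Q -> stable P -> stable Q.
Proof. by move=> /funext ->. Qed.

(** If [u ^ 2 = 0] then [1 + u = exp u], so conjugation by [1 + u] is the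
    exponential of [ad u], whose terms beyond the second order vanish. *)
Lemma stable_conj1 P u : add_op P -> u * u = 0 -> M u -> stable P ->
  stable (fun x => (1 - u) * P ((1 + u) * x)).
Proof.
move=> addP uu0 Mu stP; apply: (@stable_div _ 1).
have stPu := stable_comm stP Mu.
(* Twice the conjugate is [2 P + 2 [P, u] + [[P, u], u]]. *)
apply: (stable_eq _ (stableD (stableD stP stP)
  (stableD (stableD stPu stPu) (stable_comm stPu Mu)))) => x.
have [ux0 uP0] : P (u * (u * x)) = 0 /\ u * (u * P x) = 0.
  by rewrite !mulrA uu0 !mul0r add_op0.
rewrite /comm [(1 + u) * x]mulrDl mul1r addP [u * (P _ - _)]mulrBr ux0 uP0 mulr2n; ring.
Qed.

Lemma stable_conj P us : add_op P -> (forall u, u \in us -> u * u = 0 /\ M u) ->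
  stable P ->
  stable (fun x => (\prod_(u <- us) (1 - u)) * P ((\prod_(u <- us) (1 + u)) * x)).
Proof.
move=> addP Mus stP; elim: us Mus => [|u us IHus] Mus.
  by apply: (stable_eq _ stP) => x; rewrite !big_nil !mul1r.
have [|uu0 Mu] := Mus u; first exact: mem_head.
have Mus' v : v \in us -> v * v = 0 /\ M v.
  by move=> vus; apply: Mus; rewrite inE vus orbT.
apply: (stable_eq _ (stable_conj1 _ uu0 Mu (IHus Mus'))) => [x|x y].
  by rewrite !big_cons !mulrA [_ * (1 + u)]mulrC.
by rewrite mulrDr addP mulrDr.
Qed.

Section ODE.
Variables (D : C -> C) (F G : {fps C}).
Hypothesis addD : add_op D.
Hypothesis GF1 : G * F = 1.
Hypothesis flowF : fps_deriv F = fps_map D F.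

Definition conj_flow (Y : {fps C}) : {fps C} := G * fps_map D (F * Y).
Definition conj_coef m y : C := conj_flow y%:S m.

(** [conj_flow] is the [s]-linear extension of the operators [conj_coef]. *)
Lemma conj_flow_coef Y m :
  conj_flow Y m = \sum_(i < m.+1) conj_coef i (Y (m - i)%N).
Proof.
rewrite /conj_coef /conj_flow fps_coefM /=.
under eq_bigr => i _ do rewrite add_op_sum // mulr_sumr.
rewrite (sum_triangle (fun i j => G i * D (F j * Y (m - i - j)%N))).
apply: eq_bigr => l _; apply: eq_bigr => i _.
rewrite -subnDA subnKC ?leq_ord //; congr (_ * D _).
exact/esym/(fps_coefMC (Y (m - l)%N) F).
Qed.

(** The equation [dQ/ds = [Q, Q 1]] for [Q = F^-1 D F]: both [dF/ds] and
    [d(F^-1)/ds] are expressed by [Q 1 = F^-1 D F 1], the logarithmic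
    derivative of [F]. *)
Lemma conj_flow_ode y :
  fps_deriv (conj_flow y%:S) =
  conj_flow (conj_flow 1 * y%:S) - conj_flow 1 * conj_flow y%:S.
Proof.
have dG : fps_deriv G = - (G * conj_flow 1).
  have d0 : fps_deriv G * F + G * fps_deriv F = 0.
    rewrite -fps_deriv_leibniz GF1; apply: fpsP => n.
    by rewrite /= mul0rn.
  have -> : fps_deriv G = (fps_deriv G * F + G * fps_deriv F) * G
                          - G * fps_deriv F * G.
    by rewrite mulrDl -mulrA [F * G]mulrC GF1 mulr1 addrK.
  by rewrite d0 mul0r add0r flowF /conj_flow mulr1 mulrC mulrA.
have dF : fps_deriv F = F * conj_flow 1.
  by rewrite flowF /conj_flow mulr1 mulrA [F * G]mulrC GF1 mul1r.
have dD (f : {fps C}) : fps_deriv (fps_map D f) = fps_map D (fps_deriv f).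
  by apply: fpsP => n /=; rewrite add_opMn.
have dy : fps_deriv y%:S = 0 by apply: fpsP => n; rewrite /= mul0rn.
rewrite {1}/conj_flow fps_deriv_leibniz dG dD fps_deriv_leibniz dy mulr0 addr0.
rewrite dF addrC -mulrA; congr (_ + _).
by rewrite mulNr /conj_flow mulr1; ring.
Qed.

(** The differential equation determines [(m + 1) Q_(m+1)] as a sum of
    commutators [[Q_i, Q_(m-i) 1]], and [Q_(m-i) 1] lies in [M] by stability. *)
Lemma stable_conj_coef :
  stable (conj_coef 0) -> forall m, stable (conj_coef m).
Proof.
move=> st0; elim/ltn_ind => -[|m] IHm //; apply: (@stable_div _ m).
have st_i (i : 'I_m.+1) :
    stable (comm (conj_coef i) (conj_coef (m - i)%N 1)).
  apply: stable_comm; first exact: IHm.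
  by apply/stable1/IHm; rewrite ltnS leq_subr.
apply: (stable_eq _ (stable_sum st_i)) => y.
have -> : conj_coef m.+1 y *+ m.+1 = fps_deriv (conj_flow y%:S) m by [].
rewrite conj_flow_ode fps_coefD fps_coefN conj_flow_coef.
rewrite [conj_flow 1 * conj_flow _]mulrC fps_coefM -sumrB.
apply: eq_bigr => i _.
by rewrite fps_coefMC /comm [_ * conj_flow 1 _]mulrC.
Qed.

End ODE.
End Flow.

(** * The logarithm of a square-zero family *)

Section SquareZero.
Variables (R : comPzRingType) (T : finType) (m : T -> R).
Hypothesis tfR : torsion_free R.
Hypothesis m_sq0 : forall J, m J * m J = 0.

Definition elsym k : R := \sum_(P : {set T} | #|P| == k) \prod_(J in P) m J.

(** [log (1 + sum m)] written without denominators: as [(sum m) ^ k] is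
    [k! elsym k], the summand [(-1) ^ (k-1) / k (sum m) ^ k] of the logarithm is
    [(-1) ^ (k-1) (k-1)! elsym k], which are the weights of the cumulants. *)
Definition sqz_log : R :=
  \sum_(k < #|T|) (-1) ^+ k * k`!%:R * elsym k.+1.

Lemma sum_mul_elsym k : (\sum_J m J) * elsym k = elsym k.+1 *+ k.+1.
Proof.
rewrite /elsym big_distrlr /= -sumrMnl.
transitivity (\sum_J \sum_(P : {set T} | (#|P| == k) && (J \notin P))
                m J * \prod_(I in P) m I).
  apply: eq_bigr => J _; rewrite [LHS](bigID (fun P : {set T} => J \in P)) /=.
  rewrite big1 ?add0r // => P /andP[_ JP].
  by rewrite (bigD1 J) //= mulrA m_sq0 mul0r.
transitivity (\sum_J \sum_(Q : {set T} | (#|Q| == k.+1) && (J \in Q))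
                \prod_(I in Q) m I).
  apply: eq_bigr => J _.
  rewrite [RHS](reindex_onto (fun P : {set T} => J |: P) (fun Q => Q :\ J)) /=.
    apply: eq_big => [P|P /andP[_ JP]]; last by rewrite big_setU1.
    rewrite setU11 andbT cardsU1; case: (boolP (J \in P)) => JP /=.
      rewrite andbF; apply/esym/negP => /andP[_ /eqP eP].
      by move: JP; rewrite -eP setD11.
    by rewrite setU1K // eqxx andbT.
  by move=> Q /andP[_ JQ]; rewrite setD1K.
rewrite (exchange_big_dep (fun Q : {set T} => #|Q| == k.+1)) /=; last first.
  by move=> J Q _ /andP[].
(* Each [Q] with [k + 1] elements arises from all its elements [J]. *)
apply: eq_bigr => Q /eqP cQ.
rewrite (eq_bigl (mem Q)) => [|J]; last by rewrite cQ eqxx.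
by rewrite sumr_const cQ.
Qed.

(** The family squares to zero, so the multinomial expansion of a power of its
    sum keeps only the products of distinct members. *)
Lemma sum_exp_elsym k : (\sum_J m J) ^+ k = elsym k *+ k`!.
Proof.
elim: k => [|k IHk].
  rewrite expr0 fact0 mulr1n /elsym (big_pred1 set0) ?big_set0 // => P.
  by rewrite cards_eq0.
by rewrite exprS IHk mulrnAr sum_mul_elsym factS mulrnA.
Qed.

Lemma elsym_gt_card k : (#|T| < k)%N -> elsym k = 0.
Proof.
move=> ltk; rewrite /elsym big1 // => P /eqP cP.
by move: ltk; rewrite -cP ltnNge max_card.
Qed.

Lemma sqz_inv : (\sum_(k < #|T|.+1) (- \sum_J m J) ^+ k) * (1 + \sum_J m J) = 1.
Proof.
set X := \sum_J m J; have -> : 1 + X = - (- X - 1) by ring.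
rewrite mulrN mulrC -subrX1 exprNn [X ^+ _]sum_exp_elsym elsym_gt_card //.
by rewrite mul0rn mulr0 sub0r opprK.
Qed.

Variable D : R -> R.
Hypothesis DD : add_op D.
Hypothesis DM : forall x y, D (x * y) = D x * y + x * D y.

Lemma deriv_op1 : D 1 = 0.
Proof. by apply: (addrI (D 1)); rewrite -{3}[1]mulr1 DM mulr1 mul1r addr0. Qed.

Lemma deriv_op_exp x k : D (x ^+ k.+1) = x ^+ k * D x *+ k.+1.
Proof.
elim: k => [|k IHk]; first by rewrite expr1 expr0 mul1r.
by rewrite exprS DM IHk [RHS]mulrS mulrnAr mulrA -exprS [D x * _]mulrC.
Qed.

Lemma deriv_elsym k : D (elsym k.+1) = elsym k * D (\sum_J m J).
Proof.
case eN: (k.+1)`! (fact_gt0 k.+1) => [|N] // _.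
apply: (@torsion_free_inj R N _ _ tfR).
rewrite -eN -add_opMn // -sum_exp_elsym deriv_op_exp sum_exp_elsym.
by rewrite factS mulrnA mulrnAl mulrnAC.
Qed.

(** As [D (elsym (k+1)) = elsym k * D (sum m)], the derivative of [sqz_log] is
    the geometric series of [- sum m] times [D (sum m)]. *)
Lemma deriv_sqz_log : (1 + \sum_J m J) * D sqz_log = D (\sum_J m J).
Proof.
set X := \sum_J m J.
have -> : D sqz_log = (\sum_(k < #|T|) (- X) ^+ k) * D X.
  rewrite /sqz_log add_op_sum // mulr_suml; apply: eq_bigr => k _.
  have D_int (e : bool) j x : D ((-1) ^+ e * j%:R * x) = (-1) ^+ e * j%:R * D x.
    rewrite -!mulrA [j%:R * x]mulr_natl [j%:R * _]mulr_natl.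
    case: e; last by rewrite expr0 !mul1r add_opMn.
    by rewrite expr1 !mulN1r -[- _]add0r add_opB // add_op0 // add0r add_opMn.
  rewrite -signr_odd D_int deriv_elsym -/X [(- X) ^+ _]exprNn.
  rewrite [X ^+ k]sum_exp_elsym -[in RHS]signr_odd.
  by rewrite -[elsym k *+ _]mulr_natl !mulrA.
case: (posnP #|T|) => [T0|T_gt0].
  have X0 : X = 0 by rewrite /X big1 // => J; case: (fintype0 J).
  by rewrite X0 (add_op0 DD) !mulr0.
(* [X ^ (#|T| + 1)] vanishes, hence so does its derivative. *)
have Xn0 : X ^+ #|T| * D X = 0.
  apply: (tfR (n := #|T|)); rewrite -deriv_op_exp [X ^+ _]sum_exp_elsym.
  by rewrite elsym_gt_card // mul0rn (add_op0 DD).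
have -> : 1 + X = - (- X - 1) by ring.
by rewrite mulrA mulNr -subrX1 exprNn opprB mulrBl mul1r -mulrA Xn0 mulr0 subr0.
Qed.

End SquareZero.

(** * Signs *)

Lemma odd_abszD (x y : int) : odd (absz (x + y)) = odd (absz x) (+) odd (absz y).
Proof. lia. Qed.

Lemma odd_absz_sum (I : Type) (r : seq I) (P : pred I) (F : I -> int) :
  odd (absz (\sum_(i <- r | P i) F i)) =
  odd (\sum_(i <- r | P i) absz (F i)).
Proof.
elim/big_rec2: _ => // i x y _ e.
by rewrite odd_abszD oddD e.
Qed.

Lemma sign_odd (R : pzRingType) m n :
  odd m = odd n -> (-1) ^+ m = (-1) ^+ n :> R.
Proof. by rewrite -(signr_odd R m) -(signr_odd R n) => ->. Qed.

Lemma sign_comm (R : pzRingType) m (x : R) : x * (-1) ^+ m = (-1) ^+ m * x.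
Proof. by rewrite -signr_odd; case: odd; rewrite ?mulr1 ?mul1r // mulrN1 mulN1r. Qed.

Lemma sign_mulCA (R : pzRingType) m (x y : R) :
  x * ((-1) ^+ m * y) = (-1) ^+ m * (x * y).
Proof. by rewrite mulrA sign_comm mulrA. Qed.

Lemma fps_sign (R : pzRingType) k j (g : {fps R}) : ((-1) ^+ k * g) j = (-1) ^+ k * g j.
Proof.
by rewrite -signr_odd -[in RHS]signr_odd; case: odd; rewrite ?mul1r ?mulN1r.
Qed.

Lemma big_disjU (R : Type) (idx : R) (op : Monoid.com_law idx) (T : finType)
    (A B : {set T}) (F : T -> R) : [disjoint A & B] ->
  \big[op/idx]_(i in A :|: B) F i =
  op (\big[op/idx]_(i in A) F i) (\big[op/idx]_(i in B) F i).
Proof.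
by move=> dAB; rewrite -bigU //=; apply: eq_bigl => i; rewrite !inE.
Qed.

Lemma disjointD (T : finType) (A S : {set T}) : [disjoint A & S :\: A].
Proof. by rewrite disjoint_sym disjoints_subset setDE subsetIr. Qed.

Lemma disjointU2 (T : finType) (X Y W : {set T}) :
  [disjoint X & Y :|: W] = [disjoint X & Y] && [disjoint X & W].
Proof. by rewrite -!setI_eq0 setIUr setU_eq0. Qed.

Lemma disjointU2l (T : finType) (X Y W : {set T}) :
  [disjoint X :|: Y & W] = [disjoint X & W] && [disjoint Y & W].
Proof. by rewrite disjoint_sym disjointU2 !(disjoint_sym W). Qed.

Section Signs.
Variables (n : nat) (d : 'I_n -> int).
Implicit Types (I J S : {set 'I_n}) (w v : seq 'I_n).

(** The sign exponent of [x_I x_J = +- x_(I :|: J)], where [x_I] is the product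
    of the [x_i] in increasing order. *)
Definition cross I J : nat :=
  \sum_(i in I) \sum_(j in J | (j < i)%N) absz (d i * d j)%R.

Definition inv_exp w v : nat :=
  \sum_(x <- w) \sum_(y <- v | (y < x)%N) absz (d x * d y)%R.

Definition degs I : int := \sum_(i in I) d i.

Lemma koszul_exp_cat w v :
  koszul_exp d (w ++ v) = (koszul_exp d w + inv_exp w v + koszul_exp d v)%N.
Proof.
rewrite /inv_exp; elim: w => [|x w IHw] /=; first by rewrite big_nil.
by rewrite IHw big_cat big_cons /=; lia.
Qed.

Lemma koszul_exp_sorted w :
  sorted ltn (map val w) -> koszul_exp d w = 0%N.
Proof.
elim: w => //= x w IHw xw; rewrite IHw ?(path_sorted xw) // addn0.
rewrite big_seq_cond big1 // => y /andP[yw yx].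
have /allP/(_ (val y)) := order_path_min ltn_trans xw.
by rewrite map_f //= => /(_ isT); lia.
Qed.

Lemma enum_filter I : enum I = [seq i <- enum 'I_n | i \in I].
Proof. by rewrite {1}/enum_mem -enumT. Qed.

Lemma sorted_enum I : sorted ltn (map val (enum I)).
Proof.
rewrite enum_filter sorted_map; apply: sorted_filter; first exact: ltn_trans.
by rewrite -sorted_map val_enum_ord iota_ltn_sorted.
Qed.

Lemma koszul_exp_enum I : koszul_exp d (enum I) = 0%N.
Proof. exact/koszul_exp_sorted/sorted_enum. Qed.

Lemma crossE I w : uniq w ->
  cross I [set x in w] = inv_exp (enum I) w.
Proof.
move=> uw; rewrite /cross /inv_exp big_enum /=; apply: eq_bigr => i _.
rewrite [RHS]big_mkcond /= big_uniq //= -big_mkcondr /=.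
by apply: eq_bigl => y; rewrite inE.
Qed.

Lemma crossUl I J S : [disjoint I & J] ->
  cross (I :|: J) S = (cross I S + cross J S)%N.
Proof. by move=> dIJ; rewrite /cross big_disjU. Qed.

Lemma crossUr I J S : [disjoint I & J] ->
  cross S (I :|: J) = (cross S I + cross S J)%N.
Proof.
move=> dIJ; rewrite /cross -big_split /=; apply: eq_bigr => i _.
by rewrite big_mkcondr big_disjU // -!big_mkcondr.
Qed.

Lemma degsU I J : [disjoint I & J] -> degs (I :|: J) = degs I + degs J.
Proof. by move=> dIJ; rewrite /degs big_disjU. Qed.

(** [x_I] and [x_J] commute up to the parity of the product of their degrees. *)
Lemma cross_sym I J : [disjoint I & J] ->
  odd (cross I J + cross J I) = odd (absz (degs I * degs J)).
Proof.
move=> dIJ.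
have -> : (cross I J + cross J I = \sum_(i in I) \sum_(j in J) absz (d i * d j)%R)%N.
  have -> : cross J I = (\sum_(i in I) \sum_(j in J | (i < j)%N) absz (d i * d j)%R)%N.
    rewrite /cross (exchange_big_dep (mem I)) /=; last by move=> i j _ /andP[].
    apply: eq_bigr => i iI; apply: eq_big => [j|j _]; last by rewrite mulrC.
    by rewrite [i \in I]iI.
  rewrite /cross -big_split /=; apply: eq_bigr => i iI.
  rewrite [RHS](bigID (fun j : 'I_n => (j < i)%N)) /=; congr addn.
  apply: eq_bigl => j; case jJ: (j \in J) => //=.
  have : j != i.
    by apply: contraTneq jJ => ->; rewrite (disjointFr dIJ iI).
  by rewrite -val_eqE /=; lia.
rewrite abszM oddM /degs !odd_absz_sum -oddM big_distrlr /=; congr odd.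
by apply: eq_bigr => i _; apply: eq_bigr => j _; rewrite abszM.
Qed.

End Signs.

(** * The Grassmann envelope *)

(** What the envelope needs of a graded commutative ring. There is no
    decomposition axiom, as a power series is in general not a finite sum of
    homogeneous ones. *)
Record grading (B : pzRingType) := Grading {
  gr :> int -> B -> Prop;
  gr0 : forall i, gr i 0;
  grD : forall i x y, gr i x -> gr i y -> gr i (x + y);
  grN : forall i x, gr i x -> gr i (- x);
  gr1 : gr 0 1;
  grM : forall i j x y, gr i x -> gr j y -> gr (i + j) (x * y);
  grC : forall i j x y, gr i x -> gr j y ->
    x * y = (-1) ^+ absz (i * j) * (y * x)
}.

Section GradingTheory.
Variables (B : pzRingType) (H : grading B).

Lemma gr_sum (I : Type) (r : seq I) (P : pred I) (F : I -> B) i :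
  (forall j, P j -> H i (F j)) -> H i (\sum_(j <- r | P j) F j).
Proof.
by move=> HF; elim/big_rec: _ => [|j x Pj]; [apply: gr0 | apply/grD/HF].
Qed.

Lemma gr_sign i m x : H i x -> H i ((-1) ^+ m * x).
Proof.
rewrite -signr_odd; case: odd; last by rewrite mul1r.
by rewrite mulN1r => /grN.
Qed.

Lemma gr_prod (I : Type) (r : seq I) (P : pred I) (F : I -> B) (e : I -> int) :
  (forall j, P j -> H (e j) (F j)) ->
  H (\sum_(j <- r | P j) e j) (\prod_(j <- r | P j) F j).
Proof.
move=> HF; elim: r => [|j r IHr]; first by rewrite !big_nil; apply: gr1.
by rewrite !big_cons; case: ifP => // Pj; apply: grM; first apply: HF.
Qed.

End GradingTheory.

Section Envelope.
Variables (B : pzRingType) (H : grading B) (n : nat) (d : 'I_n -> int).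

(** The element [sum_S (ev S) x_S]. As [ev S] has the degree of [x_S],
    exchanging two summands produces the same sign twice, once for the
    coefficients and once for the variables, so the ring is commutative. *)
Record env : Type := Env {
  ev :> {set 'I_n} -> B;
  evP : forall S, H (degs d S) (ev S)
}.

Lemma envP (F G : env) : (forall S, F S = G S) -> F = G.
Proof.
case: F G => [F HF] [G HG] /= /funext FG; move: HF HG; rewrite FG => HF HG.
by congr Env; apply: Prop_irrelevance.
Qed.

HB.instance Definition _ := gen_eqMixin env.
HB.instance Definition _ := gen_choiceMixin env.

Implicit Types (F G E : env) (I J S : {set 'I_n}).

Definition env_zero : env := Env (fun S => gr0 H (degs d S)).
Definition env_opp F : env := Env (fun S => grN (evP F S)).
Definition env_add F G : env := Env (fun S => grD (evP F S) (evP G S)).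

Fact env_addA : associative env_add.
Proof. by move=> F G E; apply: envP => S /=; rewrite addrA. Qed.
Fact env_addC : commutative env_add.
Proof. by move=> F G; apply: envP => S /=; rewrite addrC. Qed.
Fact env_add0 : left_id env_zero env_add.
Proof. by move=> F; apply: envP => S /=; rewrite add0r. Qed.
Fact env_addN : left_inverse env_zero env_opp env_add.
Proof. by move=> F; apply: envP => S /=; rewrite addNr. Qed.

HB.instance Definition _ :=
  GRing.isZmodule.Build env env_addA env_addC env_add0 env_addN.

Lemma evD F G S : (F + G) S = F S + G S. Proof. by []. Qed.
Lemma evN F S : (- F) S = - F S. Proof. by []. Qed.
Lemma ev_sum (T : Type) (r : seq T) (P : pred T) (F : T -> env) S :
  (\sum_(i <- r | P i) F i) S = \sum_(i <- r | P i) F i S.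
Proof. by elim/big_rec2: _ => // i x y _ <-. Qed.
Lemma evMn F m S : (F *+ m) S = F S *+ m.
Proof. by elim: m => // m IHm; rewrite !mulrS evD IHm. Qed.

(** Variables commute with coefficients, so that
    [(b x_I) (c x_J) = (b c) (x_I x_J)] holds without a sign. *)
Definition conv (f g : {set 'I_n} -> B) S : B :=
  \sum_(I : {set 'I_n} | I \subset S)
    (-1) ^+ cross d I (S :\: I) * (f I * g (S :\: I)).

Fact conv_gr F G S : H (degs d S) (conv F G S).
Proof.
apply: gr_sum => I IS; apply: gr_sign.
rewrite -{1}(setID S I) (setIidPr IS) degsU.
  by apply: grM; apply: evP.
exact: disjointD.
Qed.

Definition env_mul F G : env := Env (conv_gr F G).

Fact env_mulA : associative env_mul.
Proof.
move=> F G E; apply: envP => S; rewrite /= /conv.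
under eq_bigr => I IS do rewrite mulr_sumr mulr_sumr.
under [RHS]eq_bigr => T TS do rewrite mulr_suml mulr_sumr.
rewrite [RHS](exchange_big_dep (fun I => I \subset S)) /=; last first.
  by move=> T I TS /subset_trans; apply.
apply: eq_bigr => I IS.
rewrite (reindex_onto (fun T => T :\: I) (fun J => I :|: J)) /=; last first.
  move=> J; rewrite subsetD => /andP[_ dJI].
  rewrite setDUl setDv set0U; apply/setDidPl; exact: dJI.
apply: eq_big => [T|T /andP[TS /eqP IT]].
  apply/andP/andP => [[TS /eqP IT]|[TS IT]].
    rewrite -IT subsetUl subUset IS; split=> //.
    exact: subset_trans TS (subsetDl _ _).
  by rewrite setSD // -{2}(setID T I) (setIidPr IT).
have DD : S :\: I :\: (T :\: I) = S :\: T by rewrite setDDl IT.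
have -> : cross d I (S :\: I) = (cross d I (T :\: I) + cross d I (S :\: T))%N.
  rewrite -crossUr; last by rewrite -DD disjointD.
  by rewrite -{1}(setID (S :\: I) (T :\: I)) (setIidPr TS) DD.
have -> : cross d T (S :\: T) =
    (cross d I (S :\: T) + cross d (T :\: I) (S :\: T))%N.
  by rewrite -crossUl ?disjointD // IT.
rewrite DD [F I * _]sign_mulCA !mulrA -!exprD; congr (_ ^+ _ * _ * _ * _).
by rewrite -addnA addnC.
Qed.

Fact env_mulC : commutative env_mul.
Proof.
move=> F G; apply: envP => S; rewrite /= /conv.
rewrite (reindex_onto (fun I => S :\: I) (fun I => S :\: I)) /=; last first.
  by move=> I IS; rewrite setDDr setDv set0U; apply/setIidPr.
apply: eq_big => [I|I /andP[_ /eqP eI]].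
  rewrite subsetDl /=; apply/eqP/idP => [<-|IS]; first exact: subsetDl.
  by rewrite setDDr setDv set0U; apply/setIidPr.
rewrite eI; have dI : [disjoint S :\: I & I].
  by rewrite -setI_eq0 setIDAC setDIl setDv setI0.
rewrite (grC (evP F _) (evP G _)) mulrA -exprD; congr (_ * _).
by apply: sign_odd; have := cross_sym d dI; rewrite !oddD => <-; case: odd; case: odd.
Qed.

Definition mono_fun J (b : B) S : B := if S == J then b else 0.

Fact mono_gr J b : H (degs d J) b -> forall S, H (degs d S) (mono_fun J b S).
Proof. by move=> Hb S; rewrite /mono_fun; case: eqP => [->|_] //; apply: gr0. Qed.

Definition mono J b (Hb : H (degs d J) b) : env := Env (mono_gr Hb).

Lemma conv_mono J b g S :
  conv (mono_fun J b) g S =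
  if J \subset S then (-1) ^+ cross d J (S :\: J) * (b * g (S :\: J)) else 0.
Proof.
rewrite /conv /mono_fun; case: ifP => JS.
  rewrite (bigD1 J) //= eqxx big1 ?addr0 // => I /andP[_ /negPf->].
  by rewrite mul0r mulr0.
rewrite big1 // => I IS; case: eqP => [eI|_]; last by rewrite mul0r mulr0.
by rewrite -eI IS in JS.
Qed.

Fact degs0 : H (degs d set0) 1.
Proof. by rewrite /degs big_set0; apply: gr1. Qed.

Definition env_one : env := mono degs0.

Fact env_mul1 : left_id env_one env_mul.
Proof.
move=> F; apply: envP => S; rewrite /= conv_mono sub0set setD0 mul1r.
by rewrite /cross big_set0 mul1r.
Qed.

Fact env_mulDl : left_distributive env_mul env_add.
Proof.
move=> F G E; apply: envP => S; rewrite /= /conv -big_split /=.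
by apply: eq_bigr => I _; rewrite mulrDl mulrDr.
Qed.

HB.instance Definition _ := GRing.Zmodule_isComPzRing.Build env
  env_mulA env_mulC env_mul1 env_mulDl.

Lemma evM F G S : (F * G) S = conv F G S. Proof. by []. Qed.
Lemma ev1 S : (1 : env) S = if S == set0 then 1 else 0. Proof. by []. Qed.

Lemma torsion_free_env : torsion_free B -> torsion_free env.
Proof.
move=> tfB m F Fm0; apply: envP => S; apply: (tfB m).
by rewrite -evMn Fm0.
Qed.

End Envelope.

Section EnvelopeMonomials.
Variables (B : pzRingType) (H : grading B) (n : nat) (d : 'I_n -> int).
Local Notation C := (env H d).

(** The envelope of [B[[s]]] and the power series over the envelope of [B] are
    the same; this is the coefficient at [x_S] in the first description. *)
Definition slice (S : {set 'I_n}) (F : {fps C}) : {fps B} :=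
  FPS (fun k => F k S).

Section Family.
Variable f : {set 'I_n} -> {fps B}.
Hypothesis f_gr : forall J k, H (degs d J) (f J k).

Definition fps_mono J : {fps C} := FPS (fun k => mono (f_gr J k)).

Lemma slice1 S : slice S 1 = if S == set0 then 1 else 0.
Proof.
by apply: fpsP => -[|k]; rewrite /= ?/mono_fun; case: (S == set0).
Qed.

Lemma slice_mulm J y S : slice S (fps_mono J * y) =
  if J \subset S then (-1) ^+ cross d J (S :\: J) * (f J * slice (S :\: J) y)
  else 0.
Proof.
apply: fpsP => k; rewrite /= ev_sum.
under eq_bigr => i _ do rewrite evM conv_mono.
case: ifP => JS; last by rewrite big1.
by rewrite fps_sign -mulr_sumr.
Qed.

Lemma fps_mono_sq0 J : f set0 = 0 -> fps_mono J * fps_mono J = 0.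
Proof.
move=> f0; apply: fpsP => k; apply: envP => S.
have := congr1 (fun g : {fps B} => g k) (slice_mulm J (fps_mono J) S).
rewrite {1}/slice => /= ->; case: ifP => // JS.
suff -> : f J * slice (S :\: J) (fps_mono J) = 0 by rewrite mulr0.
have [->|J0] := eqVneq J set0; first by rewrite f0 mul0r.
have -> : slice (S :\: J) (fps_mono J) = 0.
  apply: fpsP => l; rewrite /= /mono_fun; case: eqP => // eJ.
  by have := disjointD J S; rewrite eJ -setI_eq0 setIid (negPf J0).
by rewrite mulr0.
Qed.

(** The product of monomials [f_J x_J] carries the Koszul sign of the
    concatenated word, and vanishes as soon as a variable is repeated. *)
Lemma slice_prod_mono (Js : seq {set 'I_n}) S :
  let w := flatten [seq enum J | J : {set 'I_n} <- Js] in
  slice S (\prod_(J <- Js) fps_mono J) =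
  if uniq w && (S == [set x in w])
  then (-1) ^+ koszul_exp d w * \prod_(J <- Js) f J else 0.
Proof.
elim: Js S => [|J Js IHJs] S w.
  rewrite {}/w !big_nil slice1 mulr1 /= expr0.
  by have -> : [set x in [::]] = set0 :> {set 'I_n} by apply/setP => x; rewrite !inE.
rewrite {}/w /=; set w := flatten _ in IHJs *.
rewrite !big_cons slice_mulm IHJs -/w.
have -> : uniq (enum J ++ w) && (S == [set x in enum J ++ w]) =
    (J \subset S) && (uniq w && (S :\: J == [set x in w])).
  rewrite cat_uniq enum_uniq /=.
  have -> : [set x in enum J ++ w] = J :|: [set x in w].
    by apply/setP => x; rewrite !inE mem_cat mem_enum.
  apply/andP/and3P => [[/andP[JW ->] /eqP->]|[JS -> /eqP SJ]].
    split => //; first exact: subsetUl.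
    rewrite setDUl setDv set0U; apply/eqP/setDidPl.
    rewrite disjoint_sym disjoints_subset; apply/subsetP => x xJ; rewrite !inE.
    by apply: contra JW => xw; apply/hasP; exists x; rewrite // mem_enum.
  rewrite -SJ; split; last by rewrite -{1}(setID S J) (setIidPr JS).
  rewrite andbT; apply/hasPn => x xw; rewrite mem_enum.
  have : x \in S :\: J by rewrite SJ inE.
  by rewrite inE => /andP[].
case: ifP => //= JS; case: ifP => [/andP[uw /eqP->]|_]; last by rewrite !mulr0.
rewrite koszul_exp_cat koszul_exp_enum add0n crossE // exprD.
by rewrite sign_mulCA !mulrA.
Qed.

End Family.

Section Linear.
Variable a : 'I_n -> B.
Hypothesis a_gr : forall i, H (d i) (a i).

Fact set1_gr i : H (degs d [set i]) (a i).
Proof. by rewrite /degs big_set1. Qed.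

Definition letter i : C := mono (set1_gr i).

Lemma letter_sq0 i : letter i * letter i = 0.
Proof.
apply: envP => S; rewrite evM conv_mono; case: ifP => // iS.
rewrite /= /mono_fun; case: eqP => [e|_]; last by rewrite !mulr0.
by have := setD11 i S; rewrite e set11.
Qed.

(** In increasing order the factors contribute no sign: the first letter is
    smaller than all later ones. *)
Lemma prod_letter_sorted (l : seq 'I_n) S : sorted ltn (map val l) ->
  (\prod_(i <- l) (1 + letter i)) S =
  if S \subset l then \prod_(i <- l | i \in S) a i else 0.
Proof.
elim: l S => [|i l IHl] S il.
  rewrite !big_nil ev1 -subset0 [S \subset [::]](eq_subset_r (B := mem set0)) //.
  by move=> x; rewrite inE.
have lt_i x : x \in l -> (i < x)%N.
  move=> xl; have /allP/(_ (val x)) := order_path_min ltn_trans il.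
  by apply; rewrite map_f.
have il_notin : i \notin l by apply/negP => /lt_i; rewrite ltnn.
have {}IHl T := IHl T (path_sorted il).
rewrite big_cons mulrDl mul1r evD evM conv_mono sub1set !IHl.
have subD1 : (S :\ i \subset l) = (S \subset i :: l).
  apply/subsetP/subsetP => Sl x; last first.
    by rewrite !inE => /andP[/negPf xi /Sl]; rewrite inE xi.
  by rewrite inE; case: eqVneq => //= xi xS; apply: Sl; rewrite !inE xi.
case: (boolP (i \in S)) => iS; last first.
  rewrite addr0 -subD1; have -> : S :\ i = S.
    by apply/setDidPl; rewrite disjoint_sym disjoints1.
  by rewrite big_cons (negPf iS).
have -> : S \subset l = false.
  by apply: contraNF il_notin => /subsetP/(_ i iS).
rewrite add0r subD1; case: ifP => Sil; last by rewrite !mulr0.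
have -> : cross d [set i] (S :\ i) = 0%N.
  rewrite /cross big_set1 big1 // => j /andP[jSi ji].
  have /lt_i : j \in l by move: jSi; apply/subsetP; rewrite subD1.
  by rewrite ltnNge ltnW.
rewrite mul1r big_cons iS; congr (_ * _); rewrite big_seq_cond [RHS]big_seq_cond.
apply: eq_bigl => x; rewrite !inE; case: eqP => //= ->.
by rewrite (negPf il_notin).
Qed.

Lemma prod_letter S :
  (\prod_(i <- enum 'I_n) (1 + letter i)) S = \prod_(i <- enum S) a i.
Proof.
rewrite prod_letter_sorted; last by rewrite val_enum_ord iota_ltn_sorted.
have -> : S \subset enum 'I_n by apply/subsetP => i _; rewrite mem_enum.
by rewrite -big_filter -enum_filter.
Qed.

End Linear.
End EnvelopeMonomials.

(** * Koszul brackets as sums over subsets *)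

Lemma sum_by_value (V : nmodType) (T : finType) (P : pred T) (c : T -> nat)
    (F : nat -> T -> V) n :
  \sum_(1 <= k < n.+1) \sum_(x | P x && (c x == k)) F k x =
  \sum_(x | P x && (0 < c x <= n)%N) F (c x) x.
Proof.
rewrite (exchange_big_dep P) /=; last by move=> k x _ /andP[].
rewrite [RHS]big_mkcondr; apply: eq_bigr => x Px.
rewrite -[RHS](big_nat1_eq +%R (fun k => F k x) (c x) 1 n.+1).
by apply: eq_bigl => k; rewrite Px eq_sym.
Qed.

Section Unshuffles.
Variable n : nat.
Implicit Types (I : {set 'I_n}) (s : 'S_n).

Definition word s : seq 'I_n := [seq s p | p <- enum 'I_n].
(** Unshuffles correspond to subsets: [s] is determined by the set of its first
    [i] values, and its word lists that set and then its complement. *)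
Definition shuffle_word I : seq 'I_n := enum I ++ enum (~: I).

Lemma size_word s : size (word s) = n.
Proof. by rewrite size_map size_enum_ord. Qed.

Lemma nth_word s (p : 'I_n) x0 : nth x0 (word s) p = s p.
Proof. by rewrite (nth_map p) ?size_enum_ord // nth_ord_enum. Qed.

Lemma uniq_word s : uniq (word s).
Proof. by rewrite map_inj_uniq ?enum_uniq //; apply: perm_inj. Qed.

Lemma mem_word s x : x \in word s.
Proof. by apply/mapP; exists (s^-1%g x); rewrite ?mem_enum // permKV. Qed.

Lemma size_shuffle_word I : size (shuffle_word I) = n.
Proof. by rewrite size_cat -!cardE cardsC card_ord. Qed.

Lemma uniq_shuffle_word I : uniq (shuffle_word I).
Proof.
rewrite cat_uniq !enum_uniq andbT /=; apply/hasPn => x.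
by rewrite !mem_enum inE.
Qed.

Fact shuffle_inj I : injective (fun p : 'I_n => nth p (shuffle_word I) p).
Proof.
move=> p q; rewrite (set_nth_default p) ?size_shuffle_word // => /eqP.
by rewrite nth_uniq ?size_shuffle_word ?uniq_shuffle_word // => /eqP/val_inj.
Qed.

Definition shuffle I : 'S_n := perm (@shuffle_inj I).

Lemma word_shuffle I : word (shuffle I) = shuffle_word I.
Proof.
case: (pickP 'I_n) => [x0 _|no]; last first.
  have nil_w (w : seq 'I_n) : w = [::] by case: w => // x; have := no x.
  by rewrite [LHS]nil_w [RHS]nil_w.
apply: (@eq_from_nth _ x0) => [|k]; rewrite size_word ?size_shuffle_word // => kn.
rewrite (nth_word _ (Ordinal kn)) permE /=.
by apply: set_nth_default; rewrite size_shuffle_word.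
Qed.

Definition initial i s : {set 'I_n} := [set x in take i (word s)].

Local Notation increasing := (sorted (relpre val ltn)).

Lemma unshuffleE i s : (i <= n)%N ->
  unshuffle i s = increasing (take i (word s)) && increasing (drop i (word s)).
Proof.
move=> i_le.
have tr : transitive (relpre val ltn : rel 'I_n) by move=> ? ? ?; apply: ltn_trans.
case: (pickP 'I_n) => [x0 _|no]; last first.
  have nil_w (w : seq 'I_n) : w = [::] by case: w => // x; have := no x.
  by rewrite [word s]nil_w; apply/forallP => p; have := no p.
have take_size : size (take i (word s)) = i by rewrite size_takel ?size_word.
rewrite !sorted_pairwise //.
apply/forallP/andP => [us|[/(pairwiseP x0) inc1 /(pairwiseP x0) inc2] p].
  split; apply/(pairwiseP x0) => p q; rewrite !inE.
    rewrite take_size => pi qi pq; rewrite !nth_take //.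
    have [pn qn] : (p < n /\ q < n)%N by lia.
    move/forallP/(_ (Ordinal qn))/implyP: (us (Ordinal pn)).
    by rewrite /= (nth_word s (Ordinal pn)) (nth_word s (Ordinal qn)) pq qi; apply.
  rewrite size_drop size_word => pi qi pq; rewrite !nth_drop.
  have [pn qn] : (i + p < n /\ i + q < n)%N by lia.
  move/forallP/(_ (Ordinal qn))/implyP: (us (Ordinal pn)).
  rewrite /= (nth_word s (Ordinal pn)) (nth_word s (Ordinal qn)); apply.
  by rewrite ltn_add2l pq leq_addr orbT.
apply/forallP => q; apply/implyP => /andP[pq /orP[qi|ip]].
  have pi := ltn_trans pq qi.
  have := inc1 p q; rewrite !inE take_size !nth_take //.
  by rewrite /= !nth_word; apply.
have := inc2 (p - i)%N (q - i)%N; rewrite !inE size_drop size_word !nth_drop.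
have iq : (i <= q)%N := leq_trans ip (ltnW pq).
rewrite !subnKC //= !nth_word; have := ltn_ord p; have := ltn_ord q.
by move=> pn qn; apply; lia.
Qed.

Lemma increasing_enum I : increasing (enum I).
Proof. by rewrite -sorted_map sorted_enum. Qed.

Lemma increasing_eq (u v : seq 'I_n) :
  increasing u -> increasing v -> u =i v -> u = v.
Proof.
apply: irr_sorted_eq; first by move=> ? ? ?; apply: ltn_trans.
by move=> x; apply: ltnn.
Qed.

Lemma shuffle_initial i s : (i <= n)%N -> unshuffle i s ->
  shuffle (initial i s) = s.
Proof.
move=> i_le; rewrite unshuffleE // => /andP[inc1 inc2].
have words : word (shuffle (initial i s)) = word s.
  rewrite word_shuffle /shuffle_word -[RHS](cat_take_drop i); congr (_ ++ _).
    apply: increasing_eq; rewrite ?increasing_enum // => x.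
    by rewrite mem_enum inE.
  apply: increasing_eq; rewrite ?increasing_enum // => x.
  rewrite mem_enum !inE.
  have := uniq_word s; have := mem_word s x; rewrite -(cat_take_drop i (word s)).
  rewrite mem_cat cat_uniq cat_take_drop => /orP xw /and3P[_ /hasPn disj _].
  case xd: (x \in drop _ _); first by apply: disj.
  by case: xw; rewrite ?xd // => ->.
by apply/permP => p; rewrite -!(nth_word _ p p) words.
Qed.

Lemma unshuffle_shuffle i I : (i <= n)%N ->
  unshuffle i (shuffle I) && (initial i (shuffle I) == I) = (#|I| == i).
Proof.
move=> i_le; rewrite unshuffleE // /initial word_shuffle.
apply/andP/eqP => [[_ /eqP eI]|cI].
  have := congr1 (fun A : {set 'I_n} => #|A|) eI; rewrite cardsE.
  have /card_uniqP -> := take_uniq i (uniq_shuffle_word I).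
  by rewrite size_takel ?size_shuffle_word.
rewrite /shuffle_word -cI {1 3}cardE take_size_cat // cardE drop_size_cat //.
split; first by rewrite !increasing_enum.
by apply/eqP/setP => x; rewrite inE mem_enum.
Qed.

Lemma prod_take (B : pzRingType) (a : 'I_n -> B) i s : (i <= n)%N ->
  \prod_(p < n | (p < i)%N) a (s p) = \prod_(x <- take i (word s)) a x.
Proof.
move=> i_le; rewrite -map_take big_map -[LHS]big_filter; congr bigop.
apply: (inj_map val_inj); rewrite map_take val_enum_ord take_iota (minn_idPl i_le).
rewrite -(filter_iota_ltn 0 i_le) -val_enum_ord filter_map.
by rewrite [in RHS]enumT.
Qed.

Lemma prod_drop (B : pzRingType) (a : 'I_n -> B) i s : (i <= n)%N ->
  \prod_(p < n | (i <= p)%N) a (s p) = \prod_(x <- drop i (word s)) a x.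
Proof.
move=> i_le; rewrite -map_drop big_map -[LHS]big_filter; congr bigop.
apply: (inj_map val_inj); rewrite map_drop val_enum_ord drop_iota add0n.
transitivity [seq p <- iota 0 n | (i <= p)%N].
  by rewrite -val_enum_ord filter_map [in RHS]enumT.
rewrite -{1}(subnKC i_le) iotaD filter_cat add0n.
rewrite (eq_in_filter (a2 := pred0)) ?filter_pred0; last first.
  by move=> p; rewrite mem_iota /=; lia.
by apply/all_filterP/allP => p; rewrite mem_iota; lia.
Qed.

End Unshuffles.

Lemma koszul_bracket_sets (B : pzRingType) (D : B -> B) (n : nat)
    (d : 'I_n -> int) (a : 'I_n -> B) : D 1 = 0 ->
  koszul_bracket D d a =
  \sum_(I : {set 'I_n}) (-1) ^+ koszul_exp d (shuffle_word I) *
     (-1) ^+ #|~: I| *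
     D (\prod_(i <- enum I) a i) * \prod_(i <- enum (~: I)) a i.
Proof.
move=> D1; rewrite /koszul_bracket.
pose F i (I : {set 'I_n}) := (-1) ^+ koszul_exp d (shuffle_word I) *
     (-1) ^+ (n - i) *
     D (\prod_(i <- enum I) a i) * \prod_(i <- enum (~: I)) a i.
transitivity (\sum_(1 <= i < n.+1) \sum_(I : {set 'I_n} | #|I| == i) F i I).
  rewrite !big_nat; apply: eq_bigr => i /andP[_]; rewrite ltnS => i_le.
  rewrite (reindex_onto (@shuffle n) (initial i)) /=; last first.
    by move=> s; apply: shuffle_initial.
  apply: eq_big => [I|I]; rewrite unshuffle_shuffle // => /eqP cI.
  rewrite -/(word _) prod_take // prod_drop // word_shuffle /F.
  by rewrite -cI cardE take_size_cat // drop_size_cat.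
rewrite (sum_by_value predT (fun I : {set 'I_n} => #|I|)) /=.
rewrite big_mkcond; apply: eq_bigr => I _; case: ifP => [_|].
  by rewrite /F [#|~: I|]cardsCs setCK card_ord.
have -> : (#|I| <= n)%N by rewrite -[leqRHS]card_ord max_card.
rewrite andbT lt0n => /negbFE; rewrite cards_eq0.
by move=> /eqP->; rewrite enum_set0 big_nil D1 mulr0 mul0r.
Qed.

(** * Koszul brackets by recursion on the list of arguments *)

Section ListBracket.
Variables (B : pzRingType) (P : B -> B).
Implicit Types (x y b : B) (p q : bool) (l : seq (B * bool)).

(** The part of the sum over subsets in which [P] has so far been given the
    product [x], the product [y] of parity [q] standing to its right. *)
Fixpoint expand x y q l : B :=
  if l is (b, p) :: l' then
    (-1) ^+ (p && q) * expand (x * b) y q l' - expand x (y * b) (q (+) p) l'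
  else P x * y.

Definition list_bracket l := expand 1 1 false l.

Definition parity l : bool := foldr (fun u e => u.2 (+) e) false l.

Lemma expandMsign x y q (e : bool) l :
  expand x ((-1) ^+ e * y) q l = (-1) ^+ e * expand x y q l.
Proof.
elim: l x y q => [|[b p] l IHl] x y q /=; first by rewrite sign_mulCA.
by rewrite -mulrA !IHl sign_mulCA mulrBr.
Qed.

Lemma expand_even x y b l :
  expand x y false ((b, false) :: l) =
  expand (x * b) y false l - expand x (y * b) false l.
Proof. by rewrite /= expr0 mul1r. Qed.

Lemma expand_signl (e : nat) x y q l :
  (forall z, P (- z) = - P z) ->
  expand ((-1) ^+ e * x) y q l = (-1) ^+ e * expand x y q l.
Proof.
move=> PN; elim: l x y q => [|[b p] l IHl] x y q /=.
  by rewrite -signr_odd; case: odd; rewrite ?mul1r // !mulN1r PN mulNr.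
by rewrite -mulrA !IHl sign_mulCA mulrBr.
Qed.

(** A factor [b] at the end of [y] moves to the far right:
    it crosses the arguments left outside of [P] here, and those put inside by
    the signs of [expand], so it crosses all of [l]. *)
Lemma expandMr x y b q p l :
  (forall u, u \in l -> u.1 * b = (-1) ^+ (u.2 && p) * (b * u.1)) ->
  expand x (y * b) (q (+) p) l = (-1) ^+ (p && parity l) * (expand x y q l * b).
Proof.
elim: l x y q => [|[c r] l IHl] x y q lb /=; first by rewrite andbF mul1r mulrA.
have /= cb := lb _ (mem_head _ _).
have {}lb u : u \in l -> u.1 * b = (-1) ^+ (u.2 && p) * (b * u.1).
  by move=> ul; apply: lb; rewrite inE ul orbT.
rewrite IHl //; have -> : expand x (y * b * c) (q (+) p (+) r) l =
    (-1) ^+ (r && p) * expand x (y * c * b) (q (+) r (+) p) l.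
  by rewrite -expandMsign -!mulrA cb sign_mulCA signrMK -addbA [p (+) r]addbC addbA.
rewrite IHl //.
by case: p {cb lb IHl}; case: q; case: r; case: (parity l);
  rewrite /= ?expr0 ?expr1 ?mul1r ?mulN1r ?mulrBl ?mulNr ?opprK ?opprD ?opprK.
Qed.

(** Up to signs, [K(a, b, l)] is [K(a b, l) - K(a, l) b - K(b, l) a], so brackets
    that vanish in one arity vanish in the next one. *)
Lemma list_bracket_cons2 a b p q l :
  a * b = (-1) ^+ (p && q) * (b * a) ->
  (forall u, u \in l -> u.1 * a = (-1) ^+ (u.2 && p) * (a * u.1)) ->
  (forall u, u \in l -> u.1 * b = (-1) ^+ (u.2 && q) * (b * u.1)) ->
  list_bracket ((a * b, p (+) q) :: l) = 0 ->
  list_bracket ((a, p) :: l) = 0 -> list_bracket ((b, q) :: l) = 0 ->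
  list_bracket ((a, p) :: (b, q) :: l) = 0.
Proof.
move=> ab la lb; rewrite /list_bracket /= !andbF !expr0 !mul1r.
move=> /eqP; rewrite subr_eq0 => /eqP Kab.
move=> /eqP; rewrite subr_eq0 => /eqP Ka.
move=> /eqP; rewrite subr_eq0 => /eqP Kb.
have eb : expand a b q l = expand 1 (a * b) (p (+) q) l.
  by rewrite -{1}[b]mul1r -[q]addFb !expandMr // Ka.
have ea : expand b a p l = expand 1 (b * a) (p (+) q) l.
  by rewrite -{1}[a]mul1r -[p]addFb addFb addbC !expandMr // -Kb -expandMr.
rewrite eb ea -expandMsign Kab.
by rewrite [q && p]andbC -ab !subrr.
Qed.

End ListBracket.

Section ListBracketSets.
Variables (B : pzRingType) (P : B -> B) (n : nat) (d : 'I_n -> int).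
Variable a : 'I_n -> B.
Implicit Types (I : {set 'I_n}) (l : seq 'I_n).

Definition ins I l : seq 'I_n := [seq i <- l | i \in I].
Definition outs I l : seq 'I_n := [seq i <- l | i \notin I].
Definition ptag i : bool := odd (absz (d i)).

Lemma koszul_exp_insert (u v : seq 'I_n) (i : 'I_n) :
  (forall z, z \in u ++ v -> (i < z)%N) ->
  koszul_exp d (u ++ i :: v) =
  (\sum_(x <- u) absz (d x * d i)%R + koszul_exp d (u ++ v))%N.
Proof.
elim: u => [|x u IHu] /= lt_i.
  rewrite big_nil add0n big_seq_cond big1 // => z /andP[/lt_i]; lia.
rewrite big_cons IHu => [|z zuv]; last by apply: lt_i; rewrite inE zuv orbT.
have ix : (i < x)%N by apply: lt_i; rewrite mem_head.
by rewrite !big_cat big_cons ix /=; lia.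
Qed.

(** Each argument on the list is either put inside of [P] or left outside. The
    list increases, so an argument [i] left outside is inverted exactly with
    the later ones put inside, as recorded by the parity argument of
    [expand]. *)
Lemma expand_sets x y q l : sorted ltn (map val l) ->
  expand P x y q [seq (a i, ptag i) | i <- l] =
  \sum_(I : {set 'I_n} | I \subset l)
    (-1) ^+ (koszul_exp d (ins I l ++ outs I l) + size (outs I l)
             + q * \sum_(i <- ins I l) absz (d i)) *
    (P (x * \prod_(i <- ins I l) a i) * (y * \prod_(i <- outs I l) a i)).
Proof.
elim: l x y q => [|i l IHl] x y q il.
  rewrite (big_pred1 set0) /= => [|I]; last first.
    by rewrite /= -subset0; apply: eq_subset_r => z; rewrite inE.
  by rewrite !big_nil muln0 !mulr1 expr0 mul1r.
have lt_i z : z \in l -> (i < z)%N.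
  move=> zl; have /allP/(_ (val z)) := order_path_min ltn_trans il.
  by apply; rewrite map_f.
have il_notin : i \notin l by apply/negP => /lt_i; rewrite ltnn.
have {}IHl X Y Q := IHl X Y Q (path_sorted il).
rewrite /= !IHl.
rewrite [RHS](bigID (fun I : {set 'I_n} => i \in I)) /=; congr (_ + _).
  rewrite [RHS](reindex_onto (fun I => i |: I) (fun I => I :\ i)) /=; last first.
    by move=> I /andP[_ iI]; rewrite setD1K.
  rewrite mulr_sumr.
  have sub_i I : (i |: I \subset i :: l) && (i \in i |: I) && ((i |: I) :\ i == I)
      = (I \subset l).
    rewrite setU11 andbT; apply/idP/idP => [/andP[/subsetP Sl /eqP eI]|/subsetP Il].
      apply/subsetP => z; rewrite -eI => /setD1P[zi /Sl].
      by rewrite inE (negPf zi).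
    rewrite setU1K ?eqxx; last by apply: contra il_notin => /Il.
    rewrite andbT; apply/subsetP => z; rewrite !inE => /orP[-> // | /Il ->].
    by rewrite orbT.
  apply: eq_big => [I|I Il]; first by rewrite sub_i.
  have iI : i \notin I by apply: contra il_notin; apply/subsetP.
  have ins_i : ins (i |: I) l = ins I l.
    apply: eq_in_filter => z zl; rewrite !inE; case: eqP => // ez.
    by rewrite -ez zl in il_notin.
  have outs_i : outs (i |: I) l = outs I l.
    apply: eq_in_filter => z zl; rewrite !inE; case: eqP => // ez.
    by rewrite -ez zl in il_notin.
  rewrite /= setU11 /= -!/(ins _ _) -!/(outs _ _) ins_i outs_i !big_cons.
  have := @koszul_exp_insert [::] (ins I l ++ outs I l) i.
  rewrite big_nil => /= -> => [|z]; last first.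
    by rewrite mem_cat !mem_filter => /orP[] /andP[_ /lt_i].
  rewrite mulrA -exprD [x * (a i * _)]mulrA; congr (_ * _); apply: sign_odd.
  by rewrite /ptag; case: q => /=; lia.
rewrite -sumrN; apply: eq_big => [I|I Il].
  apply/idP/andP => [/subsetP Il|[/subsetP Il iI]].
    split; last by apply: contra il_notin => /Il.
    by apply/subsetP => z /Il; rewrite inE orbC => ->.
  apply/subsetP => z zI; have := Il z zI; rewrite inE; case: eqP => // ez.
  by rewrite -ez zI in iI.
have iI : i \notin I by apply: contra il_notin; apply/subsetP.
rewrite /= iI /= (negPf iI) -!/(ins _ _) -!/(outs _ _) !big_cons mulrA -mulNr.
rewrite [in RHS]mulrA; congr (_ * _); last by rewrite !mulrA.
rewrite koszul_exp_insert => [|z]; last first.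
  by rewrite mem_cat !mem_filter => /orP[] /andP[_ /lt_i].
have -> : (\sum_(z <- ins I l) absz (d z * d i)%R =
    (\sum_(z <- ins I l) absz (d z)) * absz (d i))%N.
  by rewrite big_distrl; apply: eq_bigr => z _; rewrite abszM.
rewrite -[LHS]mulN1r -exprS; apply: sign_odd; rewrite /= !oddD !oddM !oddb /ptag /=.
case: q; case: (odd (absz (d i))); case: (odd (\sum_(_ <- _) _));
  by case: (odd (koszul_exp _ _)); case: (odd (size _)).
Qed.

Lemma koszul_bracket_list : P 1 = 0 ->
  koszul_bracket P d a = list_bracket P [seq (a i, ptag i) | i <- enum 'I_n].
Proof.
move=> P1; rewrite koszul_bracket_sets // /list_bracket expand_sets; last first.
  by rewrite val_enum_ord iota_ltn_sorted.
apply: eq_big => [I|I _].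
  by apply/esym/subsetP => i _; rewrite mem_enum.
have -> : ins I (enum 'I_n) = enum I by rewrite [RHS]enum_filter.
have -> : outs I (enum 'I_n) = enum (~: I).
  by rewrite [RHS]enum_filter; apply: eq_filter => i; rewrite inE.
by rewrite mul0n addn0 exprD -cardE !mul1r !mulrA.
Qed.

End ListBracketSets.

Section BracketLists.
Variable C : comPzRingType.
Implicit Types (P : C -> C) (u : C) (us : seq C).

Definition iter_comm P us : C -> C := foldl (@comm C) P us.

Lemma bracketsE P us : brackets P us = iter_comm P us 1.
Proof. by elim: us P => //= u us IHus P; rewrite IHus. Qed.

(** Commutators with elements of a commutative ring may be reordered, so the
    first one may be taken last. *)
Lemma iter_comm_comm P u us x :
  iter_comm (comm P u) us x = iter_comm P us (u * x) - u * iter_comm P us x.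
Proof.
elim: us P => //= v us IHus P; rewrite -/(iter_comm _ us) -IHus.
congr (iter_comm _ us x); apply/funext => y.
by rewrite /comm ![v * (u * y)]mulrCA; ring.
Qed.

Lemma expand_comm P us x y :
  expand P x y false [seq (u, false) | u <- us] = iter_comm P us x * y.
Proof.
elim: us P x y => //= u us IHus P x y; rewrite expr0 mul1r !IHus.
by rewrite -/(iter_comm _ us) iter_comm_comm [u * x]mulrC; ring.
Qed.

(** On a commutative ring all arguments count as even. *)
Lemma list_bracket_comm P us :
  list_bracket P [seq (u, false) | u <- us] = brackets P us.
Proof. by rewrite /list_bracket expand_comm mulr1 bracketsE. Qed.

Section Generators.
Variables (M Z gen : C -> Prop).
Hypothesis M0 : M 0.
Hypothesis MD : forall x y, M x -> M y -> M (x + y).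
Hypothesis ZM : forall z, Z z -> M z.
Hypothesis ZB : forall x y, Z x -> Z y -> Z (x - y).
Hypothesis ZX : forall x z, Z z -> Z (x * z).
Hypothesis M_gen : forall u, M u -> exists (s : seq C) (z : C),
  [/\ forall v, v \in s -> gen v, Z z & u = \sum_(v <- s) v + z].

(** A subgroup [M] generated by [gen] modulo an ideal [Z] that the operator
    preserves: iterated commutators need only be tested on [gen]. *)
Lemma stable_gen P : add_op P -> (forall z, Z z -> Z (P z)) ->
  (forall us, (forall u, u \in us -> gen u) -> M (brackets P us)) ->
  stable M P.
Proof.
move=> addP ZP genP us; elim: us P addP ZP genP => [|u us IHus] P addP ZP genP Mus.
  by apply: genP.
have [|s [z [gs Zz def_u]]] := M_gen (Mus u _); first exact: mem_head.
apply: IHus => [|w Zw|vs gvs|v vus]; last by apply: Mus; rewrite inE vus orbT.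
- exact: add_op_comm.
- by apply: ZB; [apply/ZP/ZX | apply/ZX/ZP].
have -> : brackets (comm P u) vs =
    \sum_(v <- s) brackets (comm P v) vs + brackets (comm P z) vs.
  rewrite {}def_u; elim: s {gs} => [|v s IHs]; first by rewrite !big_nil !add0r.
  rewrite !big_cons -!addrA -IHs -bracketsD; apply: brackets_eq => x.
  by rewrite /comm !mulrDl addP; ring.
apply: MD.
  elim: s gs {def_u} => [|v s IHs] gs; first by rewrite big_nil.
  rewrite big_cons; apply: MD; last first.
    by apply: IHs => w ws; apply: gs; rewrite inE ws orbT.
  apply: (genP (v :: vs)) => w; rewrite inE => /orP[/eqP->|/gvs //].
  by apply: gs; apply: mem_head.
apply: ZM; have : forall x, Z (comm P z x).
  by move=> x; apply: ZB; [rewrite mulrC; apply/ZP/ZX | rewrite mulrC; apply: ZX].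
elim: vs (comm P z) {gvs} => [|v vs IHvs] Q ZQ /=; first exact: ZQ.
by apply: IHvs => x; apply: ZB; [apply: ZQ | apply/ZX/ZQ].
Qed.

End Generators.
End BracketLists.

Section EnvelopeBrackets.
Variables (B : pzRingType) (H : grading B) (n : nat) (d : 'I_n -> int).
Local Notation C := (env H d).
Variable P : B -> B.
Hypothesis P_gr : forall i x, H i x -> H i (P x).
Hypothesis P0 : P 0 = 0.
Implicit Types (I J K S : {set 'I_n}) (Js : seq {set 'I_n}).

Definition env_map (F : C) : C := Env (fun S => P_gr (evP F S)).

Definition cup Js : {set 'I_n} := \bigcup_(J <- Js) J.

Fixpoint separate Js : bool :=
  if Js is J :: Js' then [disjoint J & cup Js'] && separate Js' else true.

(** The sign exponent of the product of the [x_J] for [J] in the list. *)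
Fixpoint cross_exp Js : nat :=
  if Js is J :: Js' then (cross d J (cup Js') + cross_exp Js')%N else 0%N.

Record monomial := Monomial {
  msupp : {set 'I_n};
  mcoef : B;
  mcoef_gr : H (degs d msupp) mcoef
}.

Definition to_env (g : monomial) : C := mono (mcoef_gr g).
Definition to_arg (g : monomial) : B * bool :=
  (mcoef g, odd (absz (degs d (msupp g)))).

Lemma mono_overlap I J x y (Hx : H (degs d I) x) (Hy : H (degs d J) y) :
  ~~ [disjoint I & J] -> mono Hx * mono Hy = 0.
Proof.
move=> IJ; apply: envP => S; rewrite evM conv_mono; case: ifP => // IS.
rewrite /= /mono_fun; case: eqP => [eJ|_]; last by rewrite !mulr0.
by rewrite -eJ disjointD in IJ.
Qed.

Fact monoM_gr I J x y : [disjoint I & J] ->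
  H (degs d I) x -> H (degs d J) y ->
  H (degs d (I :|: J)) ((-1) ^+ cross d I J * (x * y)).
Proof. by move=> dIJ Hx Hy; apply: gr_sign; rewrite degsU //; apply: grM. Qed.

Lemma monoM I J x y (Hx : H (degs d I) x) (Hy : H (degs d J) y)
    (dIJ : [disjoint I & J]) :
  mono Hx * mono Hy = mono (monoM_gr dIJ Hx Hy).
Proof.
apply: envP => S; rewrite evM conv_mono /= /mono_fun.
case: ifP => [IS|]; last first.
  by case: eqP => // ->; rewrite subsetUl.
have -> : (S == I :|: J) = (S :\: I == J).
  apply/eqP/eqP => [->|<-]; last by rewrite -{1}(setID S I) (setIidPr IS).
  by rewrite setDUl setDv set0U; apply/setDidPl; rewrite disjoint_sym.
by case: eqP => [->|] //; rewrite !mulr0.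
Qed.

Lemma expand0l l (y : C) q : expand env_map 0 y q l = 0.
Proof.
elim: l y q => [|[b p] l IHl] y q /=; last by rewrite mul0r !IHl mulr0 subrr.
have -> : env_map 0 = 0 by apply: envP => S; rewrite /= P0.
by rewrite mul0r.
Qed.

Lemma expand0r l (x : C) q : expand env_map x 0 q l = 0.
Proof.
elim: l x q => [|[b p] l IHl] x q /=; first by rewrite mulr0.
by rewrite mul0r !IHl mulr0 subrr.
Qed.

Lemma cup_cons J Js : cup (J :: Js) = J :|: cup Js.
Proof. exact: big_cons. Qed.

Lemma separate_mergel I J K Js : [disjoint I & K] ->
  separate [:: I :|: K, J & Js] = separate [:: I, J, K & Js].
Proof.
move=> dIK; rewrite /= !cup_cons !disjointU2 !disjointU2l dIK.
rewrite [in LHS](disjoint_sym K J).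
by do 5 (case: [disjoint _ & _] => //=); case: separate.
Qed.

Lemma separate_merger I J K Js : [disjoint J & K] ->
  separate [:: I, J :|: K & Js] = separate [:: I, J, K & Js].
Proof.
move=> dJK; rewrite /= !cup_cons !disjointU2 !disjointU2l dJK.
by do 5 (case: [disjoint _ & _] => //=); case: separate.
Qed.

(** Moving [x_K] across [x_J] to join [x_I] costs the parity of their degrees,
    which is the sign that [expand] assigns to an argument put inside. *)
Lemma cross_exp_mergel I J K Js : separate [:: I, J, K & Js] ->
  odd (cross_exp [:: I :|: K, J & Js] + cross d I K +
       (odd (absz (degs d K)) && odd (absz (degs d J)))) =
  odd (cross_exp [:: I, J, K & Js]).
Proof.
rewrite /= !cup_cons !disjointU2 -!andbA => /and5P[dIJ dIK dIR dJK /and3P[dJR dKR _]].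
have dKJ : [disjoint K & J] by rewrite disjoint_sym.
have KJ := cross_sym d dKJ; rewrite abszM oddM in KJ.
rewrite -KJ !crossUr ?disjointU2 ?dKR ?dJK ?dIJ // !crossUl //.
by rewrite !oddD oddb; do 9 case: (odd _).
Qed.

Lemma cross_exp_merger I J K Js : separate [:: I, J, K & Js] ->
  (cross_exp [:: I, J :|: K & Js] + cross d J K)%N = cross_exp [:: I, J, K & Js].
Proof.
rewrite /= !cup_cons !disjointU2 -!andbA => /and5P[dIJ dIK dIR dJK /and3P[dJR dKR _]].
rewrite !crossUr ?disjointU2 ?disjointU2l ?dKR ?dJK ?dIJ ?dJR // !crossUl //.
lia.
Qed.

(** On monomials [b x_K] the bracket of the pointwise extension of [P], in
    which every argument is even, is the signed bracket of [P] on the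
    coefficients, with one common sign for all summands. *)
Lemma expand_mono I J x y (Hx : H (degs d I) x) (Hy : H (degs d J) y)
    (gs : seq monomial) S :
  (forall z, P (- z) = - P z) ->
  let Js := [:: I, J & map msupp gs] in
  expand env_map (mono Hx) (mono Hy) false [seq (to_env g, false) | g <- gs] S =
  if separate Js && (S == cup Js)
  then (-1) ^+ cross_exp Js *
       expand P x y (odd (absz (degs d J))) (map to_arg gs)
  else 0.
Proof.
move=> PN; elim: gs I J x y Hx Hy => [|g gs IHgs] I J x y Hx Hy Js.
  have -> : expand env_map (mono Hx) (mono Hy) false
      [seq (to_env g, false) | g <- [::]] = mono (P_gr Hx) * mono Hy.
    congr (_ * _); apply: envP => T.
    by rewrite /= /mono_fun; case: eqP => // _; rewrite P0.
  rewrite {}/Js [separate _]/= [cross_exp _]/= !cup_cons /cup big_nil setU0.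
  have -> : [disjoint J & set0] by rewrite -setI_eq0 setI0.
  rewrite andbT; case: (boolP [disjoint I & J]) => dIJ; last by rewrite mono_overlap.
    rewrite monoM /= /mono_fun; case: eqP => // _.
    rewrite [cross d J set0]big1 ?addn0 // => i _.
    by rewrite big_pred0 // => j; rewrite inE.

rewrite {}/Js; set K := msupp g; set Js := map msupp gs.
rewrite [map msupp _]/= -/K -/Js.
rewrite [map _ (g :: gs)]/= expand_even evD evN.
set sep := separate _; set p := odd _; set q := odd (absz (degs d K)).
have term1 : expand env_map (mono Hx * to_env g) (mono Hy) false
      [seq (to_env g0, false) | g0 <- gs] S =
    if sep && (S == cup [:: I, J, K & Js]) then
    (-1) ^+ cross_exp [:: I, J, K & Js] * ((-1) ^+ (q && p) * 
    expand P (x * mcoef g) y p (map to_arg gs)) else 0.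
  case: (boolP [disjoint I & K]) => dIK; last first.
    rewrite mono_overlap // expand0l /sep /= !cup_cons !disjointU2 (negPf dIK).
    by rewrite andbF.
  rewrite (monoM _ _ dIK) IHgs // separate_mergel // -/Js.
  have -> : cup [:: I :|: K, J & Js] = cup [:: I, J, K & Js].
    by rewrite !cup_cons -!setUA; congr (_ :|: _); rewrite setUCA.
  case: ifP => // /andP[sepT _]; rewrite expand_signl // !mulrA -!exprD.
  congr (_ * _); apply: sign_odd; rewrite [RHS]oddD -(cross_exp_mergel sepT) -/p -/q.
  by rewrite !oddD !oddb -!addbA addbb addbF.
have term2 : expand env_map (mono Hx) (mono Hy * to_env g) false
      [seq (to_env g0, false) | g0 <- gs] S =
    if sep && (S == cup [:: I, J, K & Js]) then
    (-1) ^+ cross_exp [:: I, J, K & Js] *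
    expand P x (y * mcoef g) (p (+) q) (map to_arg gs) else 0.
  case: (boolP [disjoint J & K]) => dJK; last first.
    rewrite mono_overlap // expand0r /sep /= !cup_cons !disjointU2 (negPf dJK).
    by rewrite andbF.
  rewrite (monoM _ _ dJK) IHgs // separate_merger // -/Js.
  have -> : cup [:: I, J :|: K & Js] = cup [:: I, J, K & Js].
    by rewrite !cup_cons -!setUA.
  case: ifP => // /andP[sepT _]; rewrite degsU // odd_abszD -/p -/q.
  rewrite -(cross_exp_merger sepT) exprD -mulrA; congr (_ * _).
  by rewrite -signr_odd expandMsign signr_odd.
rewrite term1 term2; case: ifP => _; last by rewrite subrr.
by rewrite -mulrBr /= -/p -/q.
Qed.

End EnvelopeBrackets.

(** * Divisibility by powers of the variable *)

Section Divisibility.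
Variable B : pzRingType.
Implicit Types (f g : {fps B}) (m : nat).

Definition divX m f : Prop := forall j, (j < m)%N -> f j = 0.

Lemma fps_coefXM f j : (fpsX * f) j = if j is j'.+1 then f j' else 0.
Proof.
rewrite fps_coefM; case: j => [|j]; first by rewrite big_ord1 /= mul0r.
rewrite big_ord_recl /= mul0r add0r big_ord_recl /= mul1r subn1 /=.
by rewrite big1 ?addr0 // => i _; rewrite mul0r.
Qed.

Lemma fps_coefXnM m f j :
  (fpsX ^+ m * f) j = if (j < m)%N then 0 else f (j - m)%N.
Proof.
elim: m j => [|m IHm] j; first by rewrite mul1r subn0.
by rewrite exprS -mulrA fps_coefXM; case: j => // j; rewrite IHm.
Qed.

Lemma fpsX_comm f : f * fpsX = fpsX * f.
Proof.
apply: fpsP => j; rewrite fps_coefXM fps_coefM; case: j => [|j].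
  by rewrite big_ord1 /= mulr0.
rewrite big_ord_recr /= subnn mulr0 addr0 big_ord_recr /= subSnn mulr1.
rewrite big1 ?add0r // => i _.
by rewrite (_ : (j.+1 - i == 1)%N = false) ?mulr0 //; have := ltn_ord i; lia.
Qed.

Lemma fpsXn_comm m f : f * fpsX ^+ m = fpsX ^+ m * f.
Proof.
elim: m => [|m IHm]; first by rewrite mulr1 mul1r.
by rewrite exprS mulrA fpsX_comm -!mulrA IHm.
Qed.

Lemma divXP m f : eq0_mod (fpsX ^+ m) f <-> divX m f.
Proof.
split=> [[z ->] j jm|mf]; first by rewrite fps_coefXnM jm.
exists (FPS (fun j => f (j + m)%N)); apply: fpsP => j.
rewrite fps_coefXnM /=; case: ltnP => [/mf//|mj]; by rewrite subnK.
Qed.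

Lemma divX0 m : divX m 0. Proof. by []. Qed.

Lemma divXD m f g : divX m f -> divX m g -> divX m (f + g).
Proof. by move=> mf mg j jm; rewrite fps_coefD mf ?mg ?addr0. Qed.

Lemma divXN m f : divX m f -> divX m (- f).
Proof. by move=> mf j jm; rewrite fps_coefN mf ?oppr0. Qed.

Lemma divX_sign e m f : divX m f -> divX m ((-1) ^+ e * f).
Proof.
rewrite -signr_odd; case: odd; rewrite ?mul1r // mulN1r; exact: divXN.
Qed.

Lemma divX_sum m (I : Type) (r : seq I) (P : pred I) (F : I -> {fps B}) :
  (forall i, P i -> divX m (F i)) -> divX m (\sum_(i <- r | P i) F i).
Proof.
by move=> mF; elim/big_ind: _ => // f g; apply: divXD.
Qed.

Lemma divX_leq m m' f : (m' <= m)%N -> divX m f -> divX m' f.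
Proof. by move=> le_m mf j jm; apply/mf/(leq_trans jm). Qed.

Lemma divXM m m' f g : divX m f -> divX m' g -> divX (m + m') (f * g).
Proof.
move=> mf mg j jm; rewrite fps_coefM big1 // => i _.
case: (ltnP i m) => im; first by rewrite mf // mul0r.
by rewrite mg ?mulr0 //; have := ltn_ord i; lia.
Qed.

Lemma divXn m : divX m (fpsX ^+ m).
Proof. by move=> j jm; rewrite -[fpsX ^+ m]mulr1 fps_coefXnM jm. Qed.

End Divisibility.

Lemma divX_constP (B : pzRingType) m (F : {fps {fps B}}) :
  eq0_mod (fpsX%:S ^+ m) F <-> forall j, divX m (F j).
Proof.
have coefC z j : (fpsX%:S ^+ m * z) j = fpsX ^+ m * (z : {fps {fps B}}) j.
  elim: m => [|m IHm]; first by rewrite !mul1r.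
  by rewrite !exprS -!mulrA fps_coefCM IHm.
split=> [[z ->] j|mF].
  by rewrite coefC; apply/divXP; exists (z j).
have {}mF j : {z | F j = fpsX ^+ m * z}.
  by apply: cid; apply/divXP/mF.
exists (FPS (fun j => projT1 (mF j))); apply: fpsP => j.
by rewrite coefC /=; case: (mF j).
Qed.

(** * Graded power series *)

Section GradedSeries.
Variables (K : fieldType) (charK : [pchar K] =i pred0) (A : algType K).
Variables (G : gradedCom A) (k : int) (oddk : odd (absz k)).

Lemma hom_sum (I : Type) (r : seq I) (P : pred I) (F : I -> A) i :
  (forall j, P j -> G i (F j)) -> G i (\sum_(j <- r | P j) F j).
Proof.
by move=> HF; elim/big_rec: _ => [|j x Pj]; [apply: hom0 | apply/homD/HF].
Qed.

Lemma homN i (x : A) : G i x -> G i (- x).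
Proof. by rewrite -scaleN1r; apply: homZ. Qed.

Fact fps_hom0 i : fps_hom k G i 0. Proof. by move=> j; apply: hom0. Qed.
Fact fps_homD i f g : fps_hom k G i f -> fps_hom k G i g -> fps_hom k G i (f + g).
Proof. by move=> Hf Hg j; apply: homD. Qed.
Fact fps_homN i f : fps_hom k G i f -> fps_hom k G i (- f).
Proof. by move=> Hf j; apply: homN. Qed.

Lemma fps_homC i a : G i a -> fps_hom k G i a%:S.
Proof. by move=> Ga [|j] /=; [rewrite mul0r subr0 | apply: hom0]. Qed.

Fact fps_hom1 : fps_hom k G 0 1.
Proof. exact/fps_homC/hom1. Qed.

Fact fps_homM i j f g :
  fps_hom k G i f -> fps_hom k G j g -> fps_hom k G (i + j) (f * g).
Proof.
move=> Hf Hg m; rewrite fps_coefM; apply: hom_sum => l _.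
have -> : i + j - m%:Z * (1 - k) =
    (i - l%:Z * (1 - k)) + (j - (m - l)%N%:Z * (1 - k)).
  have -> : m%:Z = l%:Z + (m - l)%N%:Z by have := ltn_ord l; lia.
  ring.
exact: homM.
Qed.

(** [t] has even degree, hence contributes no sign. *)
Lemma odd_shift i m : odd (absz (i - m%:Z * (1 - k))%R) = odd (absz i).
Proof.
have ev : odd (absz (1 - k)%R) = false by rewrite odd_abszD abszN oddk.
by rewrite odd_abszD abszN abszM oddM ev andbF addbF.
Qed.

Fact fps_homCom i j f g : fps_hom k G i f -> fps_hom k G j g ->
  f * g = (-1) ^+ absz (i * j) * (g * f).
Proof.
move=> Hf Hg; apply: fpsP => m.
have -> : ((-1) ^+ absz (i * j) * (g * f)) m =
    (-1) ^+ absz (i * j) * (g * f : {fps A}) m.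
  by rewrite fps_sign.
rewrite !fps_coefM mulr_sumr (reindex_inj rev_ord_inj); apply: eq_bigr => l _.
rewrite /= subSS subKn ?leq_ord // (homC (Hf _) (Hg _)); congr (_ * _).
by apply: sign_odd; rewrite !abszM !oddM !odd_shift.
Qed.

Definition series_grading : grading {fps A} :=
  Grading fps_hom0 fps_homD fps_homN fps_hom1 fps_homM fps_homCom.

Lemma char0_natr m : m.+1%:R != 0 :> K.
Proof. by have /pcharf0P -> := charK. Qed.

Lemma torsion_free_alg : torsion_free A.
Proof.
move=> m x /eqP; rewrite -scaler_nat scaler_eq0 (negPf (char0_natr m)).
by move/eqP.
Qed.

End GradedSeries.

Lemma map_nth_enum (T U : Type) (x0 : T) (f : T -> U) (l : seq T) :
  [seq f (nth x0 l i) | i : 'I_(size l) <- enum 'I_(size l)] = map f l.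
Proof.
transitivity (map f (mkseq (nth x0 l) (size l))); last by rewrite mkseq_nth.
by rewrite /mkseq -val_enum_ord -!map_comp.
Qed.

Section SeriesLinear.
Variables (K : fieldType) (A : algType K) (G : gradedCom A).
Variable Delta : {linear {fps A} -> {fps A}}.

Lemma fpsXn_scale m (f : {fps A}) : fpsX ^+ m * f = (fpsX ^+ m : {fps K}) *: f.
Proof.
elim: m f => [|m IHm] f; first by rewrite !expr0 mul1r; rewrite (scale1r f).
rewrite !exprS -mulrA -scalerA IHm; apply: fpsP => j.
rewrite fps_coefXM [RHS]fps_coefZ; case: j => [|j]; first by rewrite big_ord1 scale0r.
rewrite [RHS]big_ord_recl /= scale0r add0r [RHS]big_ord_recl scale1r subn1.
by rewrite [X in _ + X]big1 ?addr0 // => i _; rewrite scale0r.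
Qed.

Lemma Delta_fpsXn m f : Delta (fpsX ^+ m * f) = fpsX ^+ m * Delta f.
Proof. by rewrite !fpsXn_scale linearZ. Qed.

Lemma divX_Delta m f : divX m f -> divX m (Delta f).
Proof.
by move=> /divXP [z ->]; rewrite Delta_fpsXn; apply/divXP; exists (Delta z).
Qed.

(** * Koszul brackets and the order filtration *)

Definition bracket_divX :=
  forall (n : nat) (d : 'I_n -> int) (a : 'I_n -> A),
    (2 <= n)%N -> (forall i, G (d i) (a i)) ->
    divX n.-1 (koszul_bracket Delta d (fun i => (a i)%:S)).

(** In arity at most one the exponent is zero and there is nothing to check. *)
Lemma list_bracket_divX (l : seq (A * int)) :
  bracket_divX -> Delta 1 = 0 ->
  (forall u, u \in l -> G u.2 u.1) ->
  divX (size l).-1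
    (list_bracket Delta [seq (u.1%:S, odd (absz u.2)) | u <- l]).
Proof.
move=> br D1 Gl; case: (ltnP 1 (size l)) => [l2|l1]; last first.
  by have -> : (size l).-1 = 0%N by lia.
pose d (i : 'I_(size l)) := (nth (0, 0) l i).2.
pose a (i : 'I_(size l)) := (nth (0, 0) l i).1.
have := br _ d a l2; rewrite koszul_bracket_list // /ptag.
rewrite (map_nth_enum (0, 0) (fun u => (u.1%:S, odd (absz u.2))) l); apply.
by move=> i; apply: Gl; apply: mem_nth.
Qed.

Lemma expand_scale (l : seq (nat * {fps A} * bool)) e f x y q :
  expand Delta (fpsX ^+ e * x) (fpsX ^+ f * y) q
    [seq (fpsX ^+ u.1.1 * u.1.2, u.2) | u <- l] =
  fpsX ^+ (e + f + sumn [seq u.1.1 | u <- l]) *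
    expand Delta x y q [seq (u.1.2, u.2) | u <- l].
Proof.
elim: l e f x y q => [|[[m c] p] l IHl] e f x y q /=.
  by rewrite Delta_fpsXn addn0 exprD -!mulrA; congr (_ * _); rewrite !mulrA fpsXn_comm.
rewrite !mulrA -[fpsX ^+ e * x * _]mulrA -[fpsX ^+ f * y * _]mulrA !fpsXn_comm.
rewrite !mulrA -!exprD -![fpsX ^+ _ * _ * _]mulrA !IHl mulrBr sign_mulCA.
by congr (_ * (_ ^+ _ * _) - _ ^+ _ * _); lia.
Qed.

End SeriesLinear.

Section Stability.
Variables (K : fieldType) (charK : [pchar K] =i pred0) (A : algType K).
Variables (G : gradedCom A) (k : int) (oddk : odd (absz k)).
Variable Delta : {linear {fps A} -> {fps A}}.
Hypothesis Delta_deg0 : has_degree (fps_hom k G) 0 Delta.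
Hypothesis Delta1 : Delta 1 = 0.
Variables (n : nat) (d : 'I_n -> int).

Local Notation H := (series_grading G oddk).
Local Notation C := (env H d).
Implicit Types (S J : {set 'I_n}) (F : C).

Fact Delta_gr i x : H i x -> H i (Delta x).
Proof. by move=> /Delta_deg0; rewrite addr0. Qed.

Definition env_Delta : C -> C := env_map Delta_gr.

Lemma env_Delta_add : add_op env_Delta.
Proof. by move=> F F'; apply: envP => S; rewrite /= linearD. Qed.

(** The exponent is truncated at zero: the coefficient at the empty set is
    unrestricted. *)
Definition admissible F : Prop := forall S, divX #|S|.-1 (F S).

(** As [#|S| <= n], divisibility by [t ^ n] implies every condition of
    admissibility; modulo these elements only finitely many powers of [t]
    matter. *)
Definition negligible F : Prop := forall S, divX n (F S).

Lemma admissible0 : admissible 0.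
Proof. by move=> S; apply: divX0. Qed.

Lemma admissibleD F F' : admissible F -> admissible F' -> admissible (F + F').
Proof. by move=> MF MF' S; apply: divXD. Qed.

Lemma admissible_div m F : admissible (F *+ m.+1) -> admissible F.
Proof.
move=> MF S j jS; apply: (torsion_free_alg charK (n := m)).
by rewrite -fps_coefMn -evMn MF.
Qed.

(** An element [t ^ m c x_J] with [c] in [A] homogeneous. The power of [t]
    shifts degrees by an even number, so the signs see only that [c] and [x_J]
    have degrees of the same parity. *)
Record scaled_monomial := ScaledMonomial {
  sm_mono : monomial H d;
  sm_exp : nat;
  sm_coef : A;
  sm_deg : int;
  sm_coefE : mcoef sm_mono = fpsX ^+ sm_exp * sm_coef%:S;
  sm_coef_hom : G sm_deg sm_coef;
  sm_deg_odd : odd (absz sm_deg) = odd (absz (degs d (msupp sm_mono)));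
  sm_supp : (#|msupp sm_mono| <= sm_exp.+1)%N
}.

Fact coef_gr F J m : H (degs d J) (fpsX ^+ m * (F J m)%:S).
Proof.
move=> j; rewrite fps_coefXnM; case: ltnP => mj; first exact: hom0.
rewrite /=; case: eqP => [|_]; last exact: hom0.
move=> jm; have -> : j = m by lia.
exact: (evP F J).
Qed.

Lemma card_le_of_pred J m : (#|J|.-1 <= m)%N -> (#|J| <= m.+1)%N.
Proof. lia. Qed.

Definition scaled_coef F J m (le_m : (#|J|.-1 <= m)%N) : scaled_monomial :=
  @ScaledMonomial (Monomial (coef_gr F J m)) m (F J m)
    (degs d J - m%:Z * (1 - k)) erefl (evP F J m) (odd_shift oddk _ _)
    (card_le_of_pred le_m).

Definition monomial_class (u : C) := exists g, u = to_env (sm_mono g).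

Lemma admissible_gen u : admissible u -> exists (s : seq C) (z : C),
  [/\ forall v, v \in s -> monomial_class v, negligible z & u = \sum_(v <- s) v + z].
Proof.
move=> Mu.
pose low (p : {set 'I_n} * 'I_n) := (#|p.1|.-1 <= p.2)%N.
pose f (p : {set 'I_n} * 'I_n) : C := mono (coef_gr u p.1 p.2).
exists [seq f p | p <- enum low], (u - \sum_(v <- [seq f p | p <- enum low]) v).
split; last by rewrite addrC subrK.
  move=> v /mapP[p]; rewrite mem_enum => low_p ->.
  by exists (scaled_coef u low_p).
move=> S j jn; rewrite evD evN big_map big_enum ev_sum fps_coefD fps_coefN.
rewrite fps_coef_sum big_mkcond (bigD1 (S, Ordinal jn)) //= big1 ?addr0.
  rewrite /in_mem /= /low /=; case: leqP => [le_j|/Mu->]; last by rewrite subr0.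
  by rewrite /mono_fun eqxx fps_coefXnM ltnn subnn subrr.
move=> [T i] /= neq; case: ifP => // _; rewrite /mono_fun.
case: eqP => [eS|//]; rewrite fps_coefXnM; case: ltnP => // ij /=.
case: eqP => // ji; case/eqP: neq; rewrite eS; congr (_, _).
by apply/val_inj => /=; lia.
Qed.

(** The bracket of [n] monomials [t ^ m_i c_i x_(J_i)] is divisible by
    [t ^ (n - 1 + sum_i m_i)], and [#|J_i| <= m_i + 1]. *)
Lemma brackets_monomials us : bracket_divX G Delta ->
  (forall u, u \in us -> monomial_class u) ->
  admissible (brackets env_Delta us).
Proof.
move=> brD mus.
have {mus} [L ->] : exists L, us = [seq to_env (sm_mono g) | g <- L].
  elim: us mus => [|u us IHus] mus; first by exists [::].
  have [|g ->] := mus u; first exact: mem_head.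
  have [|L ->] := IHus; first by move=> v vus; apply: mus; rewrite inE vus orbT.
  by exists (g :: L).
move=> S; rewrite -list_bracket_comm /list_bracket -map_comp.
have -> : [seq ((fun u => (u, false)) \o (fun g => to_env (sm_mono g))) i | i <- L] =
    [seq (to_env g, false) | g <- map sm_mono L] by rewrite -map_comp.
have exp_mono := @expand_mono _ H n d Delta Delta_gr (linear0 Delta) set0 set0
  1 1 (degs0 H d) (degs0 H d) (map sm_mono L) S (linearN Delta).
rewrite [X in divX _ X]exp_mono {exp_mono}.
case: ifP => [/andP[_ /eqP->]|_]; last exact: divX0.
apply: divX_sign; rewrite /degs big_set0 /= !cup_cons !set0U.
pose args := [seq (sm_exp g, (sm_coef g)%:S, odd (absz (sm_deg g))) | g <- L].
have -> : map (@to_arg _ H n d) (map sm_mono L) =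
    [seq (fpsX ^+ u.1.1 * u.1.2, u.2) | u <- args].
  rewrite -!map_comp; apply: eq_map => g.
  by rewrite /to_arg /= sm_coefE sm_deg_odd.
rewrite -[X in expand _ X]mul1r -[X in expand _ _ X]mul1r.
rewrite -[X in expand _ (X * _)](expr0 fpsX).
rewrite -[X in expand _ _ (X * _)](expr0 fpsX) expand_scale !add0n.
have brL := list_bracket_divX (l := [seq (sm_coef g, sm_deg g) | g <- L]) brD Delta1.
rewrite -map_comp size_map in brL.
rewrite /args -!map_comp.
apply: (divX_leq _ (divXM (@divXn _ _) (brL _))); last first.
  elim: L {args brL} => //= g L IHL u; rewrite inE => /orP[/eqP->|/IHL //].
  exact: sm_coef_hom.
have : (#|cup [seq msupp (sm_mono g) | g <- L]| <=
    sumn [seq sm_exp g | g <- L] + size L)%N.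
  elim: L {args brL} => [|g L IHL] /=; first by rewrite /cup big_nil cards0.
  rewrite cup_cons; have := sm_supp g.
  have [le_U _] := leq_card_setU (msupp (sm_mono g))
    (cup [seq msupp (sm_mono g) | g <- L]).
  by move=> le_g; apply: (leq_trans le_U); apply: (leq_trans (leq_add le_g IHL)); lia.
by rewrite /comp /=; lia.
Qed.

Lemma stable_env_Delta : bracket_divX G Delta -> stable admissible env_Delta.
Proof.
move=> brD; apply: (stable_gen (Z := negligible) (gen := monomial_class)).
- exact: admissible0.
- exact: admissibleD.
- move=> z Zz S; apply: divX_leq (Zz S).
  have : (#|S| <= n)%N by rewrite -[leqRHS]card_ord max_card.
  lia.
- by move=> x y Zx Zy S; apply: divXD => //; apply: divXN.
- move=> x z Zz S; rewrite evM; apply: divX_sum => I _; apply: divX_sign.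
  have x0 : divX 0 (x I) by [].
  exact: divXM x0 (Zz _).
- exact: admissible_gen.
- exact: env_Delta_add.
- by move=> z Zz S; apply: divX_Delta.
by move=> us; apply: brackets_monomials.
Qed.

End Stability.

(** * Cumulants of the flow *)

Lemma partitionP (n : nat) (P : {set {set 'I_n}}) :
  let w := flatten [seq enum J | J : {set 'I_n} <- enum P] in
  partition P [set: 'I_n] =
  [&& set0 \notin P, uniq w & [set: 'I_n] == [set x in w]].
Proof.
move=> w; have in_w x : (x \in w) = (x \in cover P).
  apply/flattenP/bigcupP => [[_ /mapP[J JP ->] xJ]|[J JP xJ]].
    by rewrite !mem_enum in JP xJ; exists J.
  by exists (enum J); rewrite ?mem_enum //; apply/mapP; exists J; rewrite ?mem_enum.
have -> : [set x in w] = cover P by apply/setP => x; rewrite inE in_w.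
have size_w : size w = (\sum_(J in P) #|J|)%N.
  rewrite size_flatten /shape -map_comp sumnE big_map big_enum.
  by apply: eq_bigr => J _; rewrite /= cardE.
have card_w : #|[set x in w]| = #|cover P|.
  by congr #|pred_of_set _|; apply/setP => x; rewrite inE in_w.
have triv_w : trivIset P = uniq w.
  rewrite /trivIset -size_w -card_w cardsE.
  by apply/eqP/card_uniqP => ->.
by rewrite /partition eq_sym triv_w andbA andbC [_ && uniq w]andbC.
Qed.

Section Cumulants.
Variables (K : fieldType) (charK : [pchar K] =i pred0) (A : algType K).
Variables (G : gradedCom A) (k : int) (oddk : odd (absz k)).
Variable Delta : {linear {fps A} -> {fps A}}.
Hypothesis Delta_deg0 : has_degree (fps_hom k G) 0 Delta.
Hypothesis Delta1 : Delta 1 = 0.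
Variables (n : nat) (d : 'I_n -> int) (a : 'I_n -> A).
Hypothesis a_hom : forall i, G (d i) (a i).

Local Notation H := (series_grading G oddk).
Local Notation C := (env H d).
Local Notation DeltaC := (env_Delta (oddk := oddk) Delta_deg0 (d := d)).
Implicit Types (S J : {set 'I_n}).

(** The coefficient of [s ^ m] in [exp (s Delta) c]. *)
Definition flow m (c : {fps A}) : {fps A} :=
  ((m`!)%:R^-1 : K)%:S *: iter m Delta c.

Lemma iter_Delta0 m : iter m Delta 0 = 0.
Proof. by elim: m => //= m ->; rewrite linear0. Qed.

Lemma exp_flowC (c : {fps A}) m : exp_flow Delta c%:S m = flow m c.
Proof.
rewrite /exp_flow /= big_ord_recr /= subnn big1 ?add0r // => i _.
by rewrite subn_eq0 leqNgt ltn_ord /= iter_Delta0 scaler0.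
Qed.

Lemma flow0 c : flow 0 c = c.
Proof.
rewrite /flow fact0 invr1 /=.
exact: (scale1r c).
Qed.

Lemma flowS m c : flow m.+1 c *+ m.+1 = Delta (flow m c).
Proof.
rewrite /flow linearZ /= -scaler_nat scalerA; congr (_ *: _).
have -> : m.+1%:R = (m.+1%:R)%:S :> {fps K}.
  by apply: fpsP => j; rewrite fps_coefMn fps_coef1; case: j => //= j; rewrite mul0rn.
apply: fpsP => j; rewrite fps_coefCM /=; case: j => [|j] /=; last by rewrite mulr0.
by rewrite factS natrM invfM mulrA divff ?mul1r //; apply: char0_natr.
Qed.

Lemma flow_hom m i c : fps_hom k G i c -> fps_hom k G i (flow m c).
Proof.
move=> Hc; have Hm : fps_hom k G i (iter m Delta c).
  by elim: m => //= m Hm; apply: (Delta_gr (oddk := oddk)) Hm.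
move=> j; rewrite fps_coefZ; apply: hom_sum => l _.
case: l => [[|l] /= _]; first by rewrite subn0; apply: homZ.
by rewrite scale0r; apply: hom0.
Qed.

Lemma flow1 m : flow m 1 = (m == 0)%:R.
Proof.
case: m => [|m]; first by rewrite flow0.
rewrite /flow iterSr Delta1 iter_Delta0 scaler0 //.
Qed.

Definition subset_prod S : {fps A} := \prod_(i <- enum S) (a i)%:S.

Fact subset_prod_hom S : fps_hom k G (degs d S) (subset_prod S).
Proof.
rewrite /degs /subset_prod -big_enum /=; apply: (gr_prod (H := H)) => i _.
exact/fps_homC/a_hom.
Qed.

(** The value on a block of a partition. The empty set is excluded, which makes
    all the monomials [block J x_J] square to zero. *)
Definition block J : {fps {fps A}} :=
  if J == set0 then 0 else exp_flow Delta (subset_prod J)%:S.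

Fact block_gr J m : H (degs d J) (block J m).
Proof.
rewrite /block; case: eqP => _; first exact: fps_hom0.
by rewrite exp_flowC; apply/flow_hom/subset_prod_hom.
Qed.

Definition block_mono J : {fps C} := fps_mono block_gr J.

Lemma block_sq0 J : block_mono J * block_mono J = 0.
Proof. by apply: fps_mono_sq0; rewrite /block eqxx. Qed.

Definition gen_flow : {fps C} := 1 + \sum_J block_mono J.

Lemma gen_flowE m S : gen_flow m S = flow m (subset_prod S).
Proof.
rewrite fps_coefD evD fps_coef1 fps_coef_sum ev_sum.
rewrite (bigD1 S) //= /mono_fun eqxx big1 ?addr0 => [|J /negPf JS]; last first.
  by rewrite eq_sym JS.
rewrite /block; have [->|S0] := eqVneq S set0.
  have -> : subset_prod set0 = 1 by rewrite /subset_prod enum_set0 big_nil.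
  by rewrite flow1 addr0; case: eqP => // _; rewrite ev1 eqxx.
rewrite exp_flowC; case: eqP => [_|_]; rewrite ?add0r //.
by rewrite ev1 (negPf S0) add0r.
Qed.

Lemma gen_flow_deriv : fps_deriv gen_flow = fps_map DeltaC gen_flow.
Proof.
apply: fpsP => m; apply: envP => S.
by have := flowS m (subset_prod S); rewrite -!gen_flowE -evMn.
Qed.

Let tf_fpsC : torsion_free {fps C}.
Proof.
by apply/torsion_free_fps/torsion_free_env/torsion_free_fps/torsion_free_alg.
Qed.

Definition inv_gen_flow : {fps C} :=
  \sum_(j < #|{set 'I_n}|.+1) (- \sum_J block_mono J) ^+ j.

Lemma inv_gen_flowK : inv_gen_flow * gen_flow = 1.
Proof. exact: sqz_inv block_sq0. Qed.

Definition log_gen_flow : {fps C} := sqz_log block_mono.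

Lemma deriv_log_gen_flow (D : {fps C} -> {fps C}) : add_op D ->
  (forall x y, D (x * y) = D x * y + x * D y) ->
  D log_gen_flow = inv_gen_flow * D gen_flow.
Proof.
move=> DD DM; rewrite /gen_flow DD (deriv_op1 DM) add0r.
by rewrite -(deriv_sqz_log tf_fpsC block_sq0 DD DM) mulrA inv_gen_flowK mul1r.
Qed.

(** [d/ds log F = F^-1 Delta F]. *)
Lemma log_gen_flowS m :
  log_gen_flow m.+1 *+ m.+1 = conj_coef DeltaC gen_flow inv_gen_flow m 1.
Proof.
rewrite /conj_coef /conj_flow; have -> : gen_flow * 1%:S = gen_flow := mulr1 gen_flow.
rewrite -gen_flow_deriv -deriv_log_gen_flow //.
  exact: fps_derivD.
exact: fps_deriv_leibniz.
Qed.

Let u i : C := letter (H := H) (fun i => fps_homC k (a_hom i)) i.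
Let uN i : C := letter (H := H) (fun i => fps_homC k (homN (a_hom i))) i.

Lemma gen_flow0 : gen_flow 0%N = \prod_(v <- [seq u i | i <- enum 'I_n]) (1 + v).
Proof.
apply: envP => S; rewrite gen_flowE flow0 big_map.
exact/esym/prod_letter.
Qed.

Lemma inv_gen_flow0K : inv_gen_flow 0%N * gen_flow 0%N = 1.
Proof.
have := congr1 (fun f : {fps C} => f 0%N) inv_gen_flowK.
by rewrite fps_coefM big_ord1.
Qed.

Lemma inv_gen_flow0 :
  inv_gen_flow 0%N = \prod_(v <- [seq u i | i <- enum 'I_n]) (1 - v).
Proof.
have inv : (\prod_(v <- [seq u i | i <- enum 'I_n]) (1 + v)) *
    (\prod_(v <- [seq u i | i <- enum 'I_n]) (1 - v)) = 1.
  rewrite -big_split big1_seq //= => _ /mapP[i _ ->].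
  by rewrite mulrC -subr_sqr expr1n expr2 letter_sq0 subr0.
have := congr1 (fun x => inv_gen_flow 0%N * x) inv.
by rewrite mulr1 mulrA -gen_flow0 inv_gen_flow0K mul1r.
Qed.

Lemma inv_gen_flow0E S : inv_gen_flow 0%N S = (-1) ^+ #|S| * subset_prod S.
Proof.
rewrite inv_gen_flow0 big_map.
have -> : \prod_(i <- enum 'I_n) (1 - u i) = \prod_(i <- enum 'I_n) (1 + uN i).
  apply: eq_bigr => i _; congr (_ + _); apply: envP => J.
  rewrite evN /= /mono_fun; case: eqP => _; last by rewrite oppr0.
  by apply: fpsP => -[|j] //=; rewrite oppr0.
rewrite prod_letter cardE /subset_prod; elim: (enum S) => [|i l IHl].
  by rewrite !big_nil mulr1.
rewrite !big_cons IHl /= exprS -!mulrA mulN1r.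
have -> : (- a i)%:S = - (a i)%:S by apply: fpsP => -[|j] //=; rewrite oppr0.
by rewrite mulNr sign_mulCA.
Qed.

(** At [s = 0] the logarithmic derivative is [(Delta E) E^-1], and expanding
    this product gives the bracket: [E^-1] is the generating function of the
    [-a_i]. *)
Lemma log_gen_flow1 :
  log_gen_flow 1%N [set: 'I_n] = koszul_bracket Delta d (fun i => (a i)%:S).
Proof.
rewrite -[log_gen_flow 1%N]/(log_gen_flow 1%N *+ 1) log_gen_flowS /conj_coef /conj_flow.
have -> : gen_flow * 1%:S = gen_flow := mulr1 gen_flow.
rewrite mulrC fps_coefM big_ord1 koszul_bracket_sets // evM /conv.
apply: eq_big => [I|I _]; first by rewrite subsetT.
have -> : (fps_map DeltaC gen_flow 0%N) I = Delta (gen_flow 0%N I) by [].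
rewrite subnn inv_gen_flow0E gen_flowE flow0 setTD sign_mulCA !mulrA -exprD.
have -> : koszul_exp d (shuffle_word I) = cross d I (~: I).
  rewrite koszul_exp_cat !koszul_exp_enum add0n addn0 -crossE ?enum_uniq //.
  by congr cross; apply/setP => x; rewrite inE mem_enum.
by rewrite exprD.
Qed.

(** The derivation [sum_i x_i d/dx_i]. *)
Definition euler (F : C) : C := \sum_(S : {set 'I_n}) mono (evP F S) *+ #|S|.

Lemma eulerE F S : euler F S = F S *+ #|S|.
Proof.
rewrite ev_sum (bigD1 S) //= evMn /= /mono_fun eqxx big1 ?addr0 // => J /negPf JS.
by rewrite evMn /= /mono_fun eq_sym JS mul0rn.
Qed.

Lemma eulerD : add_op euler.
Proof. by move=> F F'; apply: envP => S; rewrite !(evD, eulerE) mulrnDl. Qed.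

Lemma eulerM F F' : euler (F * F') = euler F * F' + F * euler F'.
Proof.
apply: envP => S; rewrite evD eulerE !evM /conv -sumrMnl -big_split.
apply: eq_bigr => I IS; rewrite !eulerE /= -mulrDr mulrnAl mulrnAr -mulrnDr mulrnAr.
by rewrite cardsD (setIidPr IS) subnKC // subset_leq_card.
Qed.

(** [log E = sum_i u_i] has no component of arity two or more. To see this, the
    Euler derivation is applied: it multiplies the component at [S] by [#|S|],
    and [E^-1 (euler E) = sum_i u_i]. *)
Lemma log_gen_flow0 : (2 <= n)%N -> log_gen_flow 0%N [set: 'I_n] = 0.
Proof.
move=> n2; have eulerL : euler (log_gen_flow 0%N) = \sum_i u i.
  have : fps_map euler log_gen_flow = inv_gen_flow * fps_map euler gen_flow.
    apply: deriv_log_gen_flow => [F F'|F F']; apply: fpsP => m /=; first exact: eulerD.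
    rewrite (add_op_sum _ _ _ eulerD) -big_split; apply: eq_bigr => i _ /=.
    exact: eulerM.
  move=> /(congr1 (fun f : {fps C} => f 0%N)); rewrite fps_coefM big_ord1 => e.
  have {e}-> : euler (log_gen_flow 0%N) =
      inv_gen_flow 0%N * euler (gen_flow 0%N) by exact: e.
  rewrite gen_flow0.
  have -> : euler (\prod_(v <- [seq u i | i <- enum 'I_n]) (1 + v)) =
     (\prod_(v <- [seq u i | i <- enum 'I_n]) (1 + v)) * \sum_i u i.
    rewrite -[\sum_i u i]big_enum /= big_map; elim: (enum 'I_n) => [|i l IHl].
      rewrite !big_nil mulr0; exact: (deriv_op1 eulerM).
    rewrite !big_cons eulerM IHl eulerD (deriv_op1 eulerM) add0r.
    have -> : euler (u i) = u i.
      apply: envP => S; rewrite eulerE /= /mono_fun; case: eqP => [->|_].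
        by rewrite cards1.
      by rewrite mul0rn.
    have {1}-> : u i = (1 + u i) * u i by rewrite mulrDl mul1r letter_sq0 addr0.
    ring.
  by rewrite mulrA -gen_flow0 inv_gen_flow0K mul1r.
have {}eulerL : log_gen_flow 0%N [set: 'I_n] *+ n = 0.
  have := congr1 (fun F : C => F [set: 'I_n]) eulerL.
  rewrite eulerE cardsT card_ord => ->.
  rewrite ev_sum big1 // => i _; rewrite /= /mono_fun; case: eqP => // e.
  by have := congr1 (fun S : {set 'I_n} => #|S|) e; rewrite cards1 cardsT card_ord; lia.
apply: (torsion_free_fps (torsion_free_alg charK (A := A)) (n := n.-1)).
by rewrite prednK // (leq_trans _ n2).
Qed.

Lemma slice_add S : {morph slice (d := d) (H := H) S : x y / x + y}.
Proof. by move=> x y; apply: fpsP. Qed.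

Lemma slice_sum (I : Type) (r : seq I) (P : pred I) (F : I -> {fps C}) S :
  slice S (\sum_(i <- r | P i) F i) = \sum_(i <- r | P i) slice S (F i).
Proof. by apply: (big_morph _ (slice_add S)); apply: fpsP. Qed.

Lemma slice_scale S e m (x : {fps C}) :
  slice S ((-1) ^+ e * m%:R * x) = (-1) ^+ e * m%:R * slice S x.
Proof.
have slice_nat j (y : {fps C}) : slice S (j%:R * y) = j%:R * slice S y.
  rewrite !mulr_natl; apply: fpsP => l.
  by rewrite /= !fps_coefMn evMn.
rewrite -!mulrA -slice_nat -signr_odd -[in RHS]signr_odd; case: odd.
  by rewrite !mulN1r; apply: fpsP.
by rewrite !mul1r.
Qed.

(** A product of blocks has a component at the full set exactly when the blocks
    partition it, so [log F] reduces there to a sum over partitions. *)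
Lemma cumulantE : (0 < n)%N ->
  cumulant (exp_flow Delta) d (fun i => (a i)%:S%:S) = slice [set: 'I_n] log_gen_flow.
Proof.
move=> n_gt0; rewrite /log_gen_flow /sqz_log slice_sum.
pose t (j : nat) (P : {set {set 'I_n}}) : {fps {fps A}} :=
  (-1) ^+ j.-1 * (j.-1)`!%:R *
  slice [set: 'I_n] (\prod_(J <- enum P) block_mono J).
have -> : \sum_(j < #|{set 'I_n}|)
      slice [set: 'I_n] ((-1) ^+ j * j`!%:R * elsym block_mono j.+1) =
    \sum_(1 <= j < #|{set 'I_n}|.+1)
      \sum_(P : {set {set 'I_n}} | predT P && (#|P| == j)) t j P.
  rewrite big_add1 big_mkord; apply: eq_bigr => j _.
  rewrite slice_scale /elsym slice_sum mulr_sumr; apply: eq_bigr => P _.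
  by rewrite /t big_enum.
rewrite sum_by_value /cumulant.
pose s (j : nat) (P : {set {set 'I_n}}) : {fps {fps A}} :=
    (-1) ^+ j.-1 * (j.-1)`!%:R *
    (-1) ^+ koszul_exp d (flatten [seq enum J | J : {set 'I_n} <- enum P]) *
    \prod_(J <- enum P) exp_flow Delta (\prod_(i <- enum J) (a i)%:S%:S).
rewrite (sum_by_value (fun P : {set {set 'I_n}} => partition P [set: 'I_n])
  (fun P : {set {set 'I_n}} => #|P|) s).
rewrite big_mkcond [RHS]big_mkcond; apply: eq_bigr => P _ /=.
have -> : (#|P| <= #|{set 'I_n}|)%N by rewrite max_card.
rewrite andbT /t slice_prod_mono; case: (boolP (partition P _)) => [part|].
  have := part; rewrite partitionP => /and3P[P0 -> ->].
  have P_gt0 : (0 < #|P|)%N.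
    rewrite card_gt0; apply: contraTneq part => ->.
    by rewrite /partition /cover big_set0 eq_sym -cards_eq0 cardsT card_ord eqn0Ngt n_gt0.
  have -> : (#|P| <= n)%N.
    have card_n := card_partition part; rewrite cardsT card_ord in card_n.
    rewrite -sum1_card [leqRHS]card_n.
    apply: leq_sum => J JP; rewrite card_gt0.
    by apply: contraTneq JP => ->.
  rewrite P_gt0 /s /= -mulrA; congr (_ * (_ * _)).
  rewrite big_seq [RHS]big_seq; apply: eq_bigr => J; rewrite mem_enum => JP.
  rewrite /block ifN; last by apply: contraTneq JP => ->.
  congr exp_flow; rewrite /subset_prod; elim: (enum J) => [|i l IHl].
    by rewrite !big_nil.
  by rewrite !big_cons IHl fpsCM.
rewrite partitionP => Nw; case: ifP => // _.
case: ifP => [uw|_]; last by rewrite mulr0.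
rewrite uw andbT negbK in Nw.
have /splitPr[P1 P2] : set0 \in enum P by rewrite mem_enum.
by rewrite big_cat big_cons /= {2}/block eqxx mul0r !mulr0.
Qed.

Lemma conj_gen_flow_stable : bracket_divX G Delta ->
  stable (@admissible _ _ G k oddk n d) (conj_coef DeltaC gen_flow inv_gen_flow 0).
Proof.
move=> brD; have adm_u v : v \in [seq u i | i <- enum 'I_n] ->
    v * v = 0 /\ admissible v.
  move=> /mapP[i _ ->]; split; first exact: letter_sq0.
  move=> S; rewrite /= /mono_fun; case: eqP => [->|_]; last exact: divX0.
  by rewrite cards1.
have stD : stable (@admissible _ _ G k oddk n d) DeltaC.
  by move=> us; apply: stable_env_Delta.
apply: (stable_eq _ (stable_conj (@admissibleD _ _ _ _ _ _ _)
  (@admissible_div _ charK _ _ _ _ _ _) (@env_Delta_add _ _ _ _ _ _ _ _ _) adm_u stD)) => y.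
rewrite -gen_flow0 -inv_gen_flow0 /conj_coef /conj_flow fps_coefM big_ord1.
congr (_ * _); transitivity (DeltaC ((gen_flow * y%:S) 0%N)) => //.
by rewrite fps_coefMC.
Qed.

Lemma cumulant_divX j : bracket_divX G Delta -> (2 <= n)%N ->
  divX n.-1 (cumulant (exp_flow Delta) d (fun i => (a i)%:S%:S) j).
Proof.
move=> brD n2; rewrite cumulantE; last exact: leq_trans n2.
case: j => [|m].
  have -> : slice [set: 'I_n] log_gen_flow 0%N = 0 := log_gen_flow0 n2.
  exact: divX0.
have stQ : stable (@admissible _ _ G k oddk n d)
      (conj_coef DeltaC gen_flow inv_gen_flow m).
  apply: stable_conj_coef inv_gen_flowK gen_flow_deriv (conj_gen_flow_stable brD) m.
  - exact: admissible0.
  - exact: admissibleD.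
  - exact: admissible_div.
  - exact: env_Delta_add.
have : admissible (log_gen_flow m.+1).
  by apply: (admissible_div charK (m := m)); rewrite log_gen_flowS; apply: stable1.
by move=> /(_ [set: 'I_n]); rewrite cardsT card_ord.
Qed.

Lemma bracket_cumulant : (2 <= n)%N ->
  koszul_bracket Delta d (fun i => (a i)%:S) =
  cumulant (exp_flow Delta) d (fun i => (a i)%:S%:S) 1%N.
Proof.
by move=> n2; rewrite cumulantE ?(leq_trans _ n2) // -log_gen_flow1.
Qed.

End Cumulants.

(** * Brackets of higher arity and of coefficients *)

Section Operators.
Variables (K : fieldType) (A : algType K) (G : gradedCom A).

Lemma homC_parity i j (a b : A) : G i a -> G j b ->
  a * b = (-1) ^+ (odd (absz i) && odd (absz j)) * (b * a).
Proof.
move=> Ga Gb; rewrite (homC Ga Gb); congr (_ * _); apply: sign_odd.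
by rewrite abszM oddM oddb.
Qed.

Lemma list_bracket_vanish (P : A -> A) m :
  (forall l : seq (A * int), size l = m.+1 -> (forall u, u \in l -> G u.2 u.1) ->
     list_bracket P [seq (u.1, odd (absz u.2)) | u <- l] = 0) ->
  forall l : seq (A * int), (m < size l)%N -> (forall u, u \in l -> G u.2 u.1) ->
     list_bracket P [seq (u.1, odd (absz u.2)) | u <- l] = 0.
Proof.
move=> Km l ml; have [r def_r] : {r | size l = r + m.+1}%N.
  by exists (size l - m.+1)%N; rewrite subnK.
elim: r l {ml} def_r => [|r IHr] l; first exact: Km.
case: l => [|[a i] [|[b j] l]] //=; first by lia.
move=> [sz] Gl.
have Ga : G i a by have := Gl (a, i); apply; rewrite mem_head.
have Gb : G j b by have := Gl (b, j); apply; rewrite !inE eqxx orbT.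
have {}Gl u : u \in l -> G u.2 u.1 by move=> ul; apply: Gl; rewrite !inE ul !orbT.
have comm_l c e : G e c -> forall v, v \in [seq (u.1, odd (absz u.2)) | u <- l] ->
    v.1 * c = (-1) ^+ (v.2 && odd (absz e)) * (c * v.1).
  by move=> Gc v /mapP[u /Gl Gu ->]; apply: homC_parity.
have cons0 c e : G e c ->
    list_bracket P ((c, odd (absz e)) :: [seq (u.1, odd (absz u.2)) | u <- l]) = 0.
  move=> Gc; apply: (IHr ((c, e) :: l)) => //= u; rewrite inE => /orP[/eqP->|/Gl] //.
apply: list_bracket_cons2; rewrite -?odd_abszD; try exact: cons0.
- exact: homC_parity.
- exact: comm_l.
- exact: comm_l.
- exact/cons0/homM.
Qed.

Lemma koszul_bracket_vanish (P : A -> A) m : P 1 = 0 ->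
  (forall (d : 'I_m.+1 -> int) (a : 'I_m.+1 -> A),
     (forall i, G (d i) (a i)) -> koszul_bracket P d a = 0) ->
  forall n (d : 'I_n -> int) (a : 'I_n -> A), (m < n)%N ->
     (forall i, G (d i) (a i)) -> koszul_bracket P d a = 0.
Proof.
move=> P1 Km n d a mn Ga; rewrite koszul_bracket_list //.
have -> : [seq (a i, ptag d i) | i <- enum 'I_n] =
    [seq (u.1, odd (absz u.2)) | u <- [seq (a i, d i) | i <- enum 'I_n]].
  by rewrite -map_comp.
apply: (list_bracket_vanish (m := m)) => [l sz Gl||u /mapP[i _ ->]]; last exact: Ga.
  2: by rewrite size_map size_enum_ord.
rewrite -sz in Km.
have := Km (fun i => (nth (0, 0) l i).2) (fun i => (nth (0, 0) l i).1).
rewrite koszul_bracket_list // /ptag.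
rewrite (map_nth_enum (0, 0) (fun u => (u.1, odd (absz u.2)))); apply=> i.
exact/Gl/mem_nth.
Qed.

Lemma expand_linear (m : nat) (c : 'I_m -> K) (E : 'I_m -> A -> A) x y q l :
  expand (fun z => \sum_(i < m) c i *: E i z) x y q l =
  \sum_(i < m) c i *: expand (E i) x y q l.
Proof.
elim: l x y q => [|[b p] l IHl] x y q /=.
  by rewrite mulr_suml; apply: eq_bigr => i _; rewrite scalerAl.
rewrite !IHl mulr_sumr -sumrB; apply: eq_bigr => i _.
by rewrite scalerBr scalerAr.
Qed.

(** The bracket commutes with taking coefficients, since its arguments are
    constant and only [D] contributes powers of [t]. *)
Lemma koszul_bracket_coef (D : {fps A} -> {fps A}) n (d : 'I_n -> int)
    (a : 'I_n -> A) j :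
  koszul_bracket D d (fun i => (a i)%:S) j = koszul_bracket (coef_endo D j) d a.
Proof.
have prodC (P : pred 'I_n) (f : 'I_n -> A) :
    \prod_(p | P p) (f p)%:S = (\prod_(p | P p) f p)%:S :> {fps A}.
  by apply/esym; apply: (big_morph _ (@fpsCM A)).
rewrite /koszul_bracket fps_coef_sum; apply: eq_bigr => i _.
rewrite fps_coef_sum; apply: eq_bigr => s _.
by rewrite !prodC fps_coefMC -!mulrA !fps_sign !mulrA.
Qed.

End Operators.

(** * The filtration on endomorphisms *)

Section Filtration.
Variables (K : fieldType) (A : algType K) (G : gradedCom A) (k : int).

Section Coefficients.
Variable D : {linear {fps A} -> {fps A}}.

Fact coef_endo_linear j : linear (coef_endo D j).
Proof.
move=> c a b; rewrite /coef_endo.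
have -> : (c *: a + b)%:S = c%:S *: a%:S + b%:S :> {fps A}.
  apply: fpsP => -[|i]; rewrite fps_coefD fps_coefZ; first by rewrite big_ord1.
  by rewrite /= big1 ?addr0 // => -[[|l] /= _] _; rewrite ?scaler0 ?scale0r.
rewrite linearP fps_coefD fps_coefZ big_ord_recl subn0 big1 ?addr0 // => i _.
by rewrite scale0r.
Qed.

HB.instance Definition _ j := GRing.isLinear.Build K A A _ (coef_endo D j)
  (coef_endo_linear j).

Lemma coef_endo1 j : D 1 = 0 -> coef_endo D j 1 = 0.
Proof. by rewrite /coef_endo => D1; rewrite -[1%:S]/(1 : {fps A}) D1. Qed.

(** Divisibility by [t ^ (n - 1)] in arity [n] asks that the brackets of [Delta_j]
    vanish for [j < n - 1], that is in all arities at least [j + 2]; the first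
    of these arities says that [Delta_j] is a differential operator of order at
    most [j + 1]. *)
Lemma bracket_divX_BV0 : has_degree (fps_hom k G) 0 D -> D 1 = 0 ->
  bracket_divX G D <-> BV0 k G D.
Proof.
move=> D0 D1; split=> [brD | [[m [c [E [BVE defD]]]] _] n d a n2 Ga j jn].
  split=> //; exists 1%N, (fun=> 1), (fun=> D); split; last first.
    by move=> x; rewrite big_ord1 scale1r.
  move=> _; split=> // [|j]; first by exists 0.
  split; last 1 first.
  - move=> d a Ga; rewrite -koszul_bracket_coef; apply: (brD) => //.
  - exists 1%N, (fun=> - (j%:Z * (1 - k))), (fun=> coef_endo D j).
    split=> [_ i x Gx|x]; last by rewrite big_ord1.
    by have := D0 i _ (fps_homC k Gx) j; rewrite addr0.
  exact: coef_endo1.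
rewrite koszul_bracket_coef koszul_bracket_list ?coef_endo1 //.
have -> : coef_endo D j = fun z => \sum_(i < m) c i *: coef_endo (E i) j z.
  apply/funext => z; rewrite /coef_endo defD fps_coef_sum; apply: eq_bigr => i _.
  rewrite fps_coefZ big_ord_recl subn0 big1 ?addr0 // => l _.
  by rewrite scale0r.
rewrite /list_bracket expand_linear big1 // => i _.
have [_ E1 /(_ j)[_ Ej1 KE]] := BVE i.
rewrite -/(list_bracket _ _) -koszul_bracket_list //.
rewrite (koszul_bracket_vanish Ej1 KE) ?scaler0 //; lia.
Qed.

End Coefficients.
End Filtration.

Theorem proposition2p9 (K : fieldType) (charK : [pchar K] =i pred0)
  (A : algType K) (G : gradedCom A) (k : int) (oddk : odd (absz k))
  (Delta : {linear {fps A} -> {fps A}})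
  (Delta_deg0 : has_degree (fps_hom k G) 0 Delta) (Delta1 : Delta 1 = 0) :
  ((forall (n : nat) (d : 'I_n -> int) (a : 'I_n -> A),
      (2 <= n)%N -> (forall i, G (d i) (a i)) ->
      eq0_mod (fpsX%:S ^+ n.-1)
        (cumulant (exp_flow Delta) d (fun i => (a i)%:S%:S)))
   <->
   (forall (n : nat) (d : 'I_n -> int) (a : 'I_n -> A),
      (2 <= n)%N -> (forall i, G (d i) (a i)) ->
      eq0_mod (fpsX ^+ n.-1) (koszul_bracket Delta d (fun i => (a i)%:S))))
  /\
  ((forall (n : nat) (d : 'I_n -> int) (a : 'I_n -> A),
      (2 <= n)%N -> (forall i, G (d i) (a i)) ->
      eq0_mod (fpsX ^+ n.-1) (koszul_bracket Delta d (fun i => (a i)%:S)))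
   <-> BV0 k G Delta).
Proof.
have brP : (forall (n : nat) (d : 'I_n -> int) (a : 'I_n -> A),
      (2 <= n)%N -> (forall i, G (d i) (a i)) ->
      eq0_mod (fpsX ^+ n.-1) (koszul_bracket Delta d (fun i => (a i)%:S))) <->
    bracket_divX G Delta.
  by split=> br n d a n2 Ga; apply/divXP; apply: br.
split; rewrite brP; last exact: bracket_divX_BV0.
split=> [cum | brD] n d a n2 Ga.
  rewrite (bracket_cumulant charK oddk Delta_deg0 Delta1 Ga n2).
  by have /divX_constP := cum n d a n2 Ga.
by apply/divX_constP => j; apply: (cumulant_divX charK oddk Delta_deg0 Delta1).
Qed.
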